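(* Let $v$ be a place of $K$ above a prime $p$, let $\mathbf{n}=(n_1,\dots,n_s)\in\mathbb{N}_+^s$ and $N=n_1+\cdots+n_s$. Then $\mu_v(\mathcal{C}_{\mathbf{n},v})^{1/d_v}\le(p^3N)^s|\Delta_\mathbf{n}|_v$. Moreover, if $|\alpha_i-\alpha_j|_v=1$ for all $i\neq j$, then $\mu_v(\mathcal{C}_{\mathbf{n},v})^{1/d_v}=|\Delta_\mathbf{n}|_v$.
   Context: $\mathbb{N}_+$ denotes the positive integers. $K$ is a number field, $\alpha_1,\dots,\alpha_s\in K$ distinct. For $v\mid p$: $K_v$ is the completion, $d_v=[K_v:\mathbb{Q}_p]$, $|\cdot|_v$ extends the $p$-adic absolute value with $|p|_v=p^{-1}$, $\mathcal{O}_v=\{x;|x|_v\le1\}$, $\mu_v$ is the Haar measure on $K_v$ with $\mu_v(\mathcal{O}_v)=1$ (and its $s$-fold product on $K_v^s$), and $e^x=\sum_kx^k/k!\in K_v$ when $|x|_v<p^{-1/(p-1)}$. For $\mathbf{n}\in\mathbb{N}_+^s$, $\Delta_\mathbf{n}=\prod_{i=1}^s\big((n_i-1)!\prod_{k\ne i}(\alpha_i-\alpha_k)^{n_k}\big)$. Let $E$ be the set of places that are Archimedean or ultrametric with $|\alpha_i-\alpha_j|_v\ne1$ for some $i\neq j$. For $v\mid p$, $\mathcal{C}_{\mathbf{n},v}\subset K_v^s$ is: if $v\in E$, the set of $(x_1,\dots,x_s)$ with $|x_i|_v\le p^3N\prod_k\max\{|\alpha_i-\alpha_k|_v,p^{-1/(p-1)}\}^{n_k}$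 for all $i$ and $|x_ie^{\alpha_j-\alpha_i}-x_j|_v\le p^3N\prod_k\max\{|\alpha_i-\alpha_k|_v,|\alpha_j-\alpha_k|_v\}^{n_k}$ for each pair $i,j$ with $0<|\alpha_j-\alpha_i|_v<p^{-1/(p-1)}$; if $v\notin E$, the set of $(x_1,\dots,x_s)$ with $|x_i|_v\le|(n_i-1)!|_v$ for all $i$. *)

(* Defs.v *)
From HB Require Import structures.
From mathcomp Require Import all_boot all_order all_algebra all_field.
From mathcomp Require Import all_classical all_reals all_analysis.

Set Implicit Arguments.
Unset Strict Implicit.
Unset Printing Implicit Defensive.

Import Order.TTheory GRing.Theory Num.Theory.

Local Open Scope classical_set_scope.
Local Open Scope ring_scope.

(* The norm of [normedZmodType] satisfies |x *+ n| = |x| *+ n, which fails for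
   p-adic absolute values; hence the separate notion below. *)
Definition absolute_value (R : realType) (F : fieldType) (v : F -> R) : Prop :=
  [/\ forall x, 0 <= v x,
      forall x, v x = 0 <-> x = 0,
      forall x y, v (x * y) = v x * v y
    & forall x y, v (x + y) <= v x + v y].

Definition ultrametric (R : realType) (F : fieldType) (v : F -> R) : Prop :=
  forall x y, v (x + y) <= Num.max (v x) (v y).

Record valuedField (R : realType) := ValuedField {
  vfield :> fieldType ;
  absv : vfield -> R ;
  absvP : absolute_value absv
}.

(* The carrier of F with the topology of the metric |x - y|. It is an alias
   because the library's joins of rings and metric spaces go through
   [normedZmodType]. *)
Definition vtop (R : realType) (F : valuedField R) : Type := F.

Section ValuedFieldTopology.
Variables (R : realType) (F : valuedField R).

Let dist (x y : F) : R := absv (x - y).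

Fact absv0 : absv (0 : F) = 0.
Proof. by have [_ v0 _ _] := absvP F; apply/v0. Qed.

Fact absvN (x : F) : absv (- x) = absv x.
Proof.
have [vge0 v0 vM _] := absvP F.
have v1_neq0 : absv (1 : F) != 0.
  by apply/eqP => /v0 /eqP; rewrite oner_eq0.
have v1 : absv (1 : F) = 1.
  by apply: (mulfI v1_neq0); rewrite -vM !mulr1.
have vN1 : absv (-1 : F) = 1.
  apply/eqP; rewrite -(@eqrXn2 _ 2) ?vge0 ?ler01//.
  by rewrite expr2 -vM mulrNN mulr1 v1 expr1n.
by rewrite -mulN1r vM vN1 mul1r.
Qed.

Fact dist_xx x : dist x x = 0.
Proof. by rewrite /dist subrr absv0. Qed.

Fact dist_positivity x y : dist x y = 0 -> x = y.
Proof.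
by have [_ v0 _ _] := absvP F; move=> /v0 /eqP; rewrite subr_eq0 => /eqP.
Qed.

Fact dist_sym x y : dist x y = dist y x.
Proof. by rewrite /dist -absvN opprB. Qed.

Fact dist_triangle y x z : dist x z <= dist x y + dist y z.
Proof.
have [_ _ _ vD] := absvP F.
by rewrite (le_trans _ (vD _ _))// addrA subrK.
Qed.

HB.instance Definition _ := Choice.copy (vtop F) F.
HB.instance Definition _ := isPointed.Build (vtop F) (0 : F).
HB.instance Definition _ := isMetric.Build R (vtop F)
  dist_xx dist_positivity dist_sym dist_triangle.

End ValuedFieldTopology.

Definition padic_abs (R : realType) (p : nat) (q : rat) : R :=
  if q == 0 then 0
  else p%:R ^+ logn p `|denq q| / p%:R ^+ logn p `|numq q|.

(* A place above p is represented by its normalized absolute value. *)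
Definition place_above (R : realType) (K : fieldExtType rat) (p : nat)
    (v : K -> R) : Prop :=
  absolute_value v /\ forall q : rat, v (ratr q) = padic_abs R p q.

(* Kv is complete, and K with its absolute value v is dense in it. *)
Definition is_completion (R : realType) (K : fieldExtType rat) (v : K -> R)
    (Kv : valuedField R) (iota : {rmorphism K -> Kv}) : Prop :=
  [/\ forall x, absv (iota x) = v x,
      dense (range iota : set (vtop Kv))
    & forall G : set_system (vtop Kv), ProperFilter G -> cauchy G -> cvg G].

Section LocalField.
Variables (R : realType) (Kv : valuedField R).

(* Q_p is the closure of Q in Kv. *)
Definition Qp_sub : set Kv := closure (range (@ratr Kv) : set (vtop Kv)).

(* d = [Kv : Q_p]: Kv has a basis of d elements over Q_p. *)
Definition is_local_degree (d : nat) : Prop :=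
  exists e : 'I_d -> Kv, forall x : Kv,
    exists! c : {ffun 'I_d -> Kv},
      (forall i, Qp_sub (c i)) /\ x = \sum_(i < d) c i * e i.

(* Meaningful where the exponential series converges. *)
Definition vexp (x : Kv) : Kv :=
  limn (series (fun k : nat => x ^+ k / k`!%:R) : (vtop Kv)^nat).

Definition borel := g_sigma_algebraType (@open (vtop Kv)).

Definition normalized_haar (mu : {measure set borel -> \bar R}) : Prop :=
  (forall (a : Kv) (A : set borel), measurable A ->
     mu [set a + x | x in A] = mu A) /\
  mu [set x : Kv | absv x <= 1] = 1%E.

(* muS is the s-fold product of mu, on the product sigma-algebra. *)
Definition is_product_measure (s : nat) (mu : {measure set borel -> \bar R})
    (muS : {measure set (s.-tuple borel) -> \bar R}) : Prop :=
  forall A : 'I_s -> set borel, (forall i, measurable (A i)) ->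
    muS [set x | forall i, A i (tnth x i)] = (\prod_(i < s) mu (A i))%E.

End LocalField.

Section Volume.
Variables (R : realType) (K : fieldExtType rat) (s : nat).
Variables (alpha : 'I_s -> K) (n : 'I_s -> nat).

Definition Delta : K :=
  \prod_(i < s) (((n i).-1)`!%:R *
                 \prod_(k < s | k != i) (alpha i - alpha k) ^+ n k).

Definition nsum : nat := (\sum_(i < s) n i)%N.

(* Archimedean means not ultrametric. *)
Definition in_E (v : K -> R) : Prop :=
  ~ ultrametric v \/
  (ultrametric v /\ exists i j, i != j /\ v (alpha i - alpha j) != 1).

(* p^(-1/(p-1)) *)
Definition exp_radius (p : nat) : R := p%:R `^ (- (p%:R - 1)^-1).

Variables (p : nat) (v : K -> R) (Kv : valuedField R).
Variable iota : {rmorphism K -> Kv}.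

Definition C_in_E (x : s.-tuple (borel Kv)) : Prop :=
  (forall i, absv (tnth x i : Kv) <= p%:R ^+ 3 * nsum%:R *
     \prod_(k < s) Num.max (v (alpha i - alpha k)) (exp_radius p) ^+ n k) /\
  (forall i j, 0 < v (alpha j - alpha i) < exp_radius p ->
     absv ((tnth x i : Kv) * vexp (iota (alpha j - alpha i)) - (tnth x j : Kv))
     <= p%:R ^+ 3 * nsum%:R *
        \prod_(k < s)
          Num.max (v (alpha i - alpha k)) (v (alpha j - alpha k)) ^+ n k).

Definition C_notin_E (x : s.-tuple (borel Kv)) : Prop :=
  forall i, absv (tnth x i : Kv) <= v ((n i).-1)`!%:R.

Definition Cset : set (s.-tuple (borel Kv)) :=
  [set x | (in_E v -> C_in_E x) /\ (~ in_E v -> C_notin_E x)].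

End Volume.

(* Main.v *)
(* An elimination of the points alpha_1, ..., alpha_s bounds the volume of C.
   Fixing x_i confines x_j to a ball of radius p^3 N prod_k f(k)^(n_k) with
   f(k) = max(|alpha_i - alpha_k|, |alpha_j - alpha_k|), and without x_i to
   the same with f(k) = max(|alpha_j - alpha_k|, rho), rho = p^(-1/(p-1)). If one
   removes at each step a point j realizing the least distance to another
   remaining point i (on its own when that distance is at least rho), then for
   each k the product of the f(k) over all the steps is
   rho prod_(j <> k) |alpha_j - alpha_k|. It remains to use
   rho^(n_k) <= |(n_k - 1)!|, which is Legendre's bound.

   Since C is a union of small cubes, the volumes are counted by covering C
   with finitely many cubes: no Fubini theorem is needed. The volume of a ball
   of radius r is at most r^d because the ring of integers has p^d classes
   modulo p: a maximal family that is independent modulo p is a basis over Q_p.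
   It is free because a relation over Q_p can be scaled so that its largest
   coefficient has absolute value 1, and it spans by base p expansions. *)
Require Import Defs.
From HB Require Import structures.
From mathcomp Require Import all_boot all_order all_algebra all_field.
From mathcomp Require Import all_classical all_reals all_analysis.
From mathcomp Require Import zify ring lra.

Set Implicit Arguments.
Unset Strict Implicit.
Unset Printing Implicit Defensive.

Import Order.TTheory GRing.Theory Num.Theory.

Local Open Scope classical_set_scope.
Local Open Scope ring_scope.

(** * Absolute values *)

(** If [x = y * (1 + e)] with [e > 0], then [(1 + e) ^+ n] outgrows every linear function of [n].
    Subexponential losses thus disappear on taking [n]-th roots. *)
Lemma le_of_exprn_le (R : realType) (C x y : R) : 0 <= x -> 0 <= y ->
  (forall n, x ^+ n <= C * n.+1%:R * y ^+ n) -> x <= y.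
Proof.
move=> x0 y0 h; rewrite leNgt; apply/negP => yx.
have xp : 0 < x by apply: le_lt_trans yx.
have C0 : 1 <= C by have := h 0%N; rewrite !expr0 !mulr1.
have yp : 0 < y.
  rewrite lt0r y0 andbT; apply/eqP => yE; move: (h 1%N).
  by rewrite yE !expr1 mulr0 leNgt xp.
have [e e0 xE] : exists2 e, 0 < e & x = y * (1 + e).
  exists (x / y - 1); first by rewrite subr_gt0 ltr_pdivlMr// mul1r.
  by rewrite addrC subrK mulrC divfK// gt_eqF.
have bernoulli n : 1 + n%:R * e <= (1 + e) ^+ n.
  elim: n => [|n IH]; first by rewrite mul0r addr0 expr0.
  rewrite exprS -natr1; apply: le_trans (_ : (1 + e) * (1 + n%:R * e) <= _).
    have : 0 <= n%:R * e * e by rewrite !mulr_ge0// ltW.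
    by lra.
  by rewrite ler_pM2l// addr_gt0.
(* The exponent [2 * n] squares Bernoulli's bound: the left side is now quadratic in [n], the right
   side only linear. *)
have key n : (1 + n%:R * e) ^+ 2 <= C * (2 * n).+1%:R.
  have /= := h (2 * n)%N.
  rewrite xE exprMn [leLHS]mulrC ler_pM2r ?exprn_gt0// mulnC exprM; apply: le_trans.
  rewrite ler_sqr// nnegrE ?exprn_ge0 ?addr_ge0 ?mulr_ge0//; exact: ltW.
(* With [4 * C < n * e ^+ 2] and [n >= 1], [(n * e) ^+ 2] exceeds [4 * C * n], hence
   [C * (2 * n + 1)], contradicting [key]. *)
pose n := Num.Def.archi_bound (4 * C / e ^+ 2).
have nP : 4 * C < n%:R * e ^+ 2.
  rewrite -ltr_pdivrMr ?exprn_gt0//; apply: archi_boundP.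
  by rewrite divr_ge0 ?exprn_ge0 ?mulr_ge0//; lra.
have n0 : 1 <= n%:R :> R.
  rewrite ler1n lt0n; apply/eqP => nE; move: nP; rewrite nE mul0r.
  by lra.
have := key n; rewrite -natr1 natrM.
have : n%:R * (4 * C) < n%:R * (n%:R * e ^+ 2) by rewrite ltr_pM2l//; lra.
have : 0 < n%:R * e by rewrite mulr_gt0//; lra.
have : C <= n%:R * C by rewrite ler_peMl//; lra.
rewrite !expr2; nra.
Qed.

Section AbsoluteValue.
Variables (R : realType) (F : fieldType) (v : F -> R).
Hypothesis v_abs : absolute_value v.

Lemma absolute_value1 : v 1 = 1.
Proof.
have [vge0 v0 vM _] := v_abs.
have v1 : v 1 != 0 by apply/eqP => /v0 /eqP; rewrite oner_eq0.
by apply: (mulfI v1); rewrite -vM !mulr1.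
Qed.

Lemma absolute_valueX x n : v (x ^+ n) = v x ^+ n.
Proof.
have [_ _ vM _] := v_abs.
elim: n => [|n IH]; first by rewrite !expr0 absolute_value1.
by rewrite !exprS vM IH.
Qed.

Lemma absolute_value_prod I (r : seq I) (P : pred I) (f : I -> F) :
  v (\prod_(i <- r | P i) f i) = \prod_(i <- r | P i) v (f i).
Proof.
have [_ _ vM _] := v_abs.
by apply: (big_morph v vM absolute_value1).
Qed.

Lemma absolute_valueN x : v (- x) = v x.
Proof.
have [vge0 _ vM _] := v_abs.
have vN1 : v (-1) = 1.
  apply/eqP; rewrite -(@eqrXn2 _ 2) ?vge0 ?ler01//.
  by rewrite expr2 -vM mulrNN mulr1 absolute_value1 expr1n.
by rewrite -mulN1r vM vN1 mul1r.
Qed.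

Lemma absolute_value0 : v 0 = 0.
Proof. by have [_ v0 _ _] := v_abs; apply/v0. Qed.

Lemma absolute_value_gt0 x : (0 < v x) = (x != 0).
Proof.
have [vge0 v0 _ _] := v_abs.
rewrite lt0r vge0 andbT; congr (~~ _); apply/eqP/eqP => /v0//.
Qed.

Lemma absolute_valueV x : v x^-1 = (v x)^-1.
Proof.
have [_ _ vM _] := v_abs.
have [->|x0] := eqVneq x 0; first by rewrite invr0 absolute_value0 invr0.
have vx0 : v x != 0 by rewrite gt_eqF// absolute_value_gt0.
by apply: (mulfI vx0); rewrite -vM !divff// absolute_value1.
Qed.

Lemma absolute_value_sum_le I (r : seq I) (P : pred I) (f : I -> F) :
  v (\sum_(i <- r | P i) f i) <= \sum_(i <- r | P i) v (f i).
Proof.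
have [_ _ _ vD] := v_abs.
elim/big_rec2 : _ => [|i y x _ le_xy]; first by rewrite absolute_value0.
by rewrite (le_trans (vD _ _))// lerD2l.
Qed.

(* Expand [(x + y) ^+ n], bound each of its [n + 1] terms by [max ^ n], and
   compare [n]-th powers. *)
Lemma ultrametric_nat_le1 : (forall n : nat, v n%:R <= 1) -> ultrametric v.
Proof.
move=> v_nat x y; have [vge0 _ vM _] := v_abs.
have m0 : 0 <= Num.max (v x) (v y) by rewrite le_max vge0.
apply: (@le_of_exprn_le _ 1) => // n; rewrite mul1r -absolute_valueX exprDn.
apply: le_trans (absolute_value_sum_le _ _ _) _.
apply: (@le_trans _ _ (\sum_(i < n.+1) Num.max (v x) (v y) ^+ n)); last first.
  by rewrite sumr_const card_ord mulr_natl.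
apply: ler_sum => i _; rewrite -mulr_natr !vM !absolute_valueX.
rewrite -[leRHS]mulr1 ler_pM ?mulr_ge0 ?exprn_ge0//.
have -> : Num.max (v x) (v y) ^+ n = Num.max (v x) (v y) ^+ (n - i + i).
  by rewrite subnK// -ltnS.
rewrite exprD.
by rewrite ler_pM ?exprn_ge0// lerXn2r ?nnegrE// le_max lexx ?orbT.
Qed.

Hypothesis v_um : ultrametric v.

Lemma ultrametricB x y : v (x - y) <= Num.max (v x) (v y).
Proof. by rewrite -(absolute_valueN y). Qed.

Lemma ultrametricC x y : v (x - y) = v (y - x).
Proof. by rewrite -absolute_valueN opprB. Qed.

Lemma ultrametric_le r x y : v x <= r -> v y <= r -> v (x + y) <= r.
Proof. by move=> xr yr; rewrite (le_trans (v_um _ _))// ge_max xr. Qed.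

Lemma ultrametricB_le r x y : v x <= r -> v y <= r -> v (x - y) <= r.
Proof. by move=> xr yr; rewrite ultrametric_le// absolute_valueN. Qed.

Lemma ultrametric_trans r y x z :
  v (x - y) <= r -> v (y - z) <= r -> v (x - z) <= r.
Proof. by move=> xy yz; rewrite -(subrK y x) -addrA ultrametric_le. Qed.

(** Triangles are isosceles: in [v y <= max (v x) (v (x - y))] the second term is too small to
    attain the maximum. *)
Lemma ultrametric_eq x y : v (x - y) < v y -> v x = v y.
Proof.
move=> xy; apply/eqP; rewrite eq_le.
have -> : v x <= v y by rewrite -(subrK y x) ultrametric_le// ltW.
rewrite leNgt; apply/negP => lt_xy.
have : v y <= Num.max (v x) (v (x - y)).
  by rewrite -{1}(subKr x y); exact: ultrametricB.
by rewrite le_max !leNgt lt_xy xy.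
Qed.

Lemma ultrametric_sum_le r I (s : seq I) (P : pred I) (f : I -> F) :
  0 <= r -> (forall i, P i -> v (f i) <= r) ->
  v (\sum_(i <- s | P i) f i) <= r.
Proof.
move=> r0 fr; elim/big_ind : _ => [|x y|//]; first by rewrite absolute_value0.
exact: ultrametric_le.
Qed.

End AbsoluteValue.

(** * Linear algebra over a subfield *)

Section DivringClosed.
Variables (F : fieldType) (S : divringClosed F).

(** Turns the subset [S] into a field of its own, so that ranks and kernels of matrices with entries
    in [S] can be taken over [S]. *)
Record divring_sub := DivringSub {
  divring_val :> F ;
  divring_valP : divring_val \in S
}.

HB.instance Definition _ := [isSub for divring_val].
HB.instance Definition _ := [Choice of divring_sub by <:].
HB.instance Definition _ := [SubChoice_isSubIntegralDomain of divring_sub by <:].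
HB.instance Definition _ := [SubIntegralDomain_isSubField of divring_sub by <:].

(** Over the field [S] the rank is at most [m < d], so the left kernel contains a nonzero row, which
    is then mapped into [F]. *)
Lemma divring_dependent (d m : nat) (A : 'M[F]_(d, m)) :
  (forall i j, A i j \in S) -> (m < d)%N ->
  exists u : 'rV[F]_d, [/\ u != 0, forall i, u 0 i \in S & u *m A = 0].
Proof.
move=> AS md.
pose B : 'M[divring_sub]_(d, m) := \matrix_(i, j) DivringSub (AS i j).
have AB : A = map_mx val B by apply/matrixP => i j; rewrite !mxE.
have : kermx B != 0.
  rewrite kermx_eq0 -row_leq_rank -ltnNge (leq_ltn_trans (rank_leq_col _))//.
move=> /rowV0Pn[u /sub_kermxP uB u0].
exists (map_mx val u); split.
- by rewrite map_mx_eq0.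
- by move=> i; rewrite mxE; exact: valP.
- by rewrite AB -map_mxM uB map_mx0.
Qed.

(* Writing the [e i] in terms of the [x j] gives a matrix with a kernel vector
   if [m < d]. *)
Lemma divring_indep_le_span (d m : nat) (e : 'I_d -> F) (x : 'I_m -> F) :
  (forall c : 'I_d -> F, (forall i, c i \in S) ->
    \sum_i c i * e i = 0 -> forall i, c i = 0) ->
  (forall y, exists c : 'I_m -> F, (forall j, c j \in S) /\
    y = \sum_j c j * x j) ->
  (d <= m)%N.
Proof.
move=> indep span; rewrite leqNgt; apply/negP => md.
have /choice[c cP] i := span (e i).
have [|u [u0 uS uA]] := @divring_dependent d m (\matrix_(i, j) c i j) _ md.
  by move=> i j; rewrite mxE; exact: (cP i).1.
case/rV0Pn : u0 => i /eqP; apply.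
apply: (indep (u 0)) => //.
under eq_bigr => k _ do rewrite (cP k).2 mulr_sumr.
rewrite exchange_big big1//= => j _.
under eq_bigr => k _ do rewrite mulrA.
rewrite -mulr_suml; move/matrixP : uA => /(_ 0 j); rewrite !mxE => uA.
rewrite (_ : \sum_i _ = 0) ?mul0r// -[RHS]uA.
by apply: eq_bigr => k _; rewrite mxE.
Qed.

End DivringClosed.

(** * Topology and p-adic numbers *)

Section VtopBall.
Variables (R : realType) (F : valuedField R).

Lemma vtop_nbhsP (x : F) (A : set F) :
  nbhs (x : vtop F) (A : set (vtop F)) <->
  exists2 e : R, 0 < e & forall y : F, absv (x - y) < e -> A y.
Proof.
split=> [/nbhs_ballP[e e0 xA]|[e e0 xA]]; first by exists e => // y xy; exact: xA.
by apply/nbhs_ballP; exists e => // y xy; exact: xA.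
Qed.

Lemma vtop_closureP (A : set F) (x : F) :
  closure (A : set (vtop F)) x <->
  forall e : R, 0 < e -> exists2 y : F, A y & absv (x - y) < e.
Proof.
split=> [xA e e0|xA B /vtop_nbhsP[e e0 eB]].
  have [|y [Ay xy]] := xA [set y : F | absv (x - y) < e].
    by apply/vtop_nbhsP; exists e.
  by exists y.
by have [y Ay xy] := xA _ e0; exists y; split=> //; exact: eB.
Qed.

Lemma vtop_cvg_dist (u : nat -> vtop F) (l : vtop F) (e : R) :
  u @ \oo --> l -> 0 < e ->
  exists N, forall n, (N <= n)%N -> absv ((l : F) - u n) < e.
Proof.
by move=> /cvg_ballP ul e0; have [N _ Nu] := ul _ e0; exists N => n /Nu.
Qed.

End VtopBall.

Section PadicField.
Variables (R : realType) (F : valuedField R) (p : nat) (p_prime : prime p).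
Variable phi : {rmorphism rat -> F}.
Hypothesis phi_abs : forall q, absv (phi q) = padic_abs R p q.

Let p_gt0 : 0 < p%:R :> R. Proof. by rewrite ltr0n prime_gt0. Qed.
Let p_gt1 : 1 < p%:R :> R. Proof. by rewrite ltr1n prime_gt1. Qed.
Let pV_lt1 : p%:R^-1 < 1 :> R. Proof. by rewrite invf_lt1. Qed.
Let pV_gt0 : 0 < p%:R^-1 :> R. Proof. by rewrite invr_gt0. Qed.

Lemma exprn_pV_lt (e : R) : 0 < e -> exists n, p%:R^-1 ^+ n < e.
Proof.
move=> e0; exists (Num.Def.archi_bound e^-1).
rewrite exprVn invf_plt ?posrE ?exprn_gt0//.
apply: lt_le_trans (upper_nthrootP (leqnn _)) _.
by rewrite lerXn2r ?nnegrE// ?ler0n// ler_nat prime_gt1.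
Qed.

Lemma absv_nat (n : nat) : (0 < n)%N ->
  absv (n%:R : F) = p%:R^-1 ^+ logn p n.
Proof.
move=> n0; rewrite -(rmorph_nat phi) phi_abs /padic_abs pnatr_eq0 gtn_eqF//.
rewrite -[n%:R]/(n%:Z%:Q) numq_int denq_int logn1 expr0 mul1r.
by rewrite absz_nat exprVn.
Qed.

Lemma absv_nat_le1 (n : nat) : absv (n%:R : F) <= 1.
Proof.
case: n => [|n]; first by rewrite absv0.
by rewrite absv_nat// exprn_ile1// ltW.
Qed.

Lemma absv_p : absv (p%:R : F) = p%:R^-1.
Proof. by rewrite absv_nat ?prime_gt0// logn_prime// eqxx expr1. Qed.

Lemma p_neq0 : (p%:R : F) != 0.
Proof. by rewrite -(absolute_value_gt0 (absvP F)) absv_p. Qed.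

Lemma absv_ultrametric : ultrametric (@absv R F).
Proof. exact: ultrametric_nat_le1 (absvP F) absv_nat_le1. Qed.

Let vum := absv_ultrametric.
Let vabs := absvP F.

Lemma absvM (x y : F) : absv (x * y) = absv x * absv y.
Proof. by have [] := vabs. Qed.

Lemma absv_ge0 (x : F) : 0 <= absv x.
Proof. by have [] := vabs. Qed.

Lemma absv_nat_dvd (n : nat) : (absv (n%:R : F) <= p%:R^-1) = (p %| n)%N.
Proof.
case: n => [|n]; first by rewrite absv0 dvdn0 ltW.
rewrite absv_nat//; apply/idP/idP => [|pn]; last first.
  by rewrite -[leRHS]expr1 ler_wiXn2l ?ltW// -pfactor_dvdn// expn1.
apply: contraTT => pn; rewrite -ltNge (_ : logn p n.+1 = 0%N) ?expr0//.
by apply/eqP; rewrite -leqn0 leqNgt logn_gt0 mem_primes p_prime.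
Qed.

(** The denominator [a] of [q] is prime to [p]; if [b] inverts it modulo [p], then [q] is congruent
    to [b] times its numerator. *)
Lemma padic_digit_rat (q : rat) : absv (phi q) <= 1 ->
  exists k : nat, absv (phi q - k%:R) <= p%:R^-1.
Proof.
move=> q1.
pose a := `|denq q|%N.
have a0 : (0 < a)%N by rewrite absz_gt0 denq_neq0.
have qE : phi q * a%:R = phi (numq q)%:Q.
  rewrite -(rmorph_nat phi) -rmorphM; congr (phi _).
  rewrite -[a%:R]/(a%:Z%:Q) /a absz_denq.
  by rewrite -{1}(divq_num_den q) divfK// intr_eq0 denq_neq0.
have [k nE] : exists k : nat, numq q = k%:Z \/ numq q = - k%:Z.
  by case: (numq q) => k; [exists k; left | exists k.+1; right; rewrite NegzE].
have kE : phi (numq q)%:Q = k%:R \/ phi (numq q)%:Q = - k%:R.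
  by case: nE => ->; [left|right]; rewrite rmorph_int ?mulrNz.
(* If [p] divided [a], then [absv (phi q) <= 1] would force [p] to divide the numerator as well. *)
have pa : coprime p a.
  rewrite prime_coprime//; apply/negP => pa.
  have pk : (p %| k)%N.
    rewrite -absv_nat_dvd.
    have -> : absv (k%:R : F) = absv (phi q) * absv (a%:R : F).
      by rewrite -absvM qE; case: kE => ->//; rewrite absvN.
    rewrite -[leRHS]mul1r ler_pM ?absv_ge0// absv_nat_dvd//.
  have : coprime `|numq q| `|denq q| by exact: coprime_num_den.
  have -> : `|numq q|%N = k by case: nE => ->; rewrite ?abszN absz_nat.
  by rewrite /coprime => /eqP g1; have := prime_gt1 p_prime;
    rewrite ltnNge -[X in (_ <= X)%N]g1 dvdn_leq ?gcdn_gt0 ?a0 ?orbT// dvdn_gcd pk.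
have [b b0 [c _ bc]] : exists2 b, (0 < b)%N & exists2 c, true & (b * a = c * p + 1)%N.
  case: (egcdnP p a0) => b c bc _; exists b.
    by rewrite lt0n; apply/eqP => b0; move: bc;
      rewrite b0 gcdnC (eqP pa) mul0n addn1.
  by exists c => //; rewrite bc gcdnC (eqP pa).
have vcp : absv ((c * p)%:R : F) <= p%:R^-1 by rewrite absv_nat_dvd dvdn_mull.
have qb : absv (phi q - phi q * (b * a)%:R) <= p%:R^-1.
  rewrite -{1}[phi q]mulr1 -mulrBr absvM bc natrD opprD addrCA subrr addr0 absvN.
  by rewrite -[leRHS]mul1r ler_pM ?absv_ge0.
have qE' : phi q * (b * a)%:R = phi (numq q)%:Q * b%:R.
  by rewrite natrM -qE mulrA mulrAC.
case: kE => kE.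
  by exists (k * b)%N; rewrite natrM -kE -qE'.
(* The digit has to be a natural number, so [p - 1] stands for [-1]. *)
exists ((p - 1) * (k * b))%N.
apply: (ultrametric_trans vum qb).
rewrite qE' kE mulnBl mul1n natrB ?leq_pmull ?prime_gt0//.
have -> : - k%:R * b%:R - ((p * (k * b))%:R - (k * b)%:R) = - (p * (k * b))%:R :> F.
  by rewrite !natrM; ring.
by rewrite absvN absv_nat_dvd dvdn_mulr.
Qed.

Lemma phi_ratr q : phi q = ratr q.
Proof. exact: fmorph_eq_rat. Qed.

Lemma Qp_subP (x : F) : Qp_sub x <->
  forall e : R, 0 < e -> exists q : rat, absv (x - phi q) < e.
Proof.
split=> [/vtop_closureP xQ e /xQ[_ [q _ <-]]|xQ].
  by exists q; rewrite phi_ratr.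
apply/vtop_closureP => e /xQ[q xq]; exists (phi q) => //.
by exists q; rewrite // phi_ratr.
Qed.

Lemma Qp_digit (x : F) : Qp_sub x -> absv x <= 1 ->
  exists k : nat, absv (x - k%:R) <= p%:R^-1.
Proof.
move=> /Qp_subP/(_ _ pV_gt0)[q xq] x1.
have [|k qk] := @padic_digit_rat q.
  rewrite -(subKr x (phi q)) ultrametricB_le// (le_trans (ltW xq))// ltW//.
by exists k; exact: (ultrametric_trans vum (ltW xq) qk).
Qed.

Definition Qp_pred : {pred F} := fun x => `[< Qp_sub x >].

(** The field operations are continuous, so the closure of the rationals is again a subfield. *)
Lemma Qp_divring_closed : divring_closed Qp_pred.
Proof.
split.
- apply/asboolP/Qp_subP => e e0; exists 1; by rewrite rmorph1 subrr absv0.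
- move=> x y /asboolP/Qp_subP xQ /asboolP/Qp_subP yQ.
  apply/asboolP/Qp_subP => e e0.
  have [q xq] := xQ _ e0; have [r yr] := yQ _ e0; exists (q - r).
  have -> : x - y - phi (q - r) = (x - phi q) - (y - phi r).
    by rewrite rmorphB; ring.
  by rewrite (le_lt_trans (ultrametricB vabs vum _ _))// gt_max xq.
- move=> x y /asboolP xQ /asboolP yQ.
  have yVQ : Qp_sub y^-1.
    have [->|y0] := eqVneq y 0.
      by apply/Qp_subP => e e0; exists 0; rewrite invr0 rmorph0 subrr absv0.
    have vy0 : 0 < absv y by rewrite absolute_value_gt0.
    apply/Qp_subP => e e0; move/Qp_subP : yQ => yQ.
    (* The first bound forces [absv (phi q) = absv y]; the second then controls the difference of
       the inverses, which is [absv (y - phi q) / absv y ^+ 2]. *)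
    have [|q yq] := yQ (Num.min (absv y) (e * absv y ^+ 2)).
      by rewrite lt_min vy0 mulr_gt0// exprn_gt0.
    move: yq; rewrite lt_min => /andP[yq1 yq2].
    have vq : absv (phi q) = absv y.
      by apply: (ultrametric_eq vabs vum); rewrite ultrametricC.
    have q0 : phi q != 0 by rewrite -(absolute_value_gt0 vabs) vq.
    exists q^-1; rewrite fmorphV.
    have -> : y^-1 - (phi q)^-1 = - (y - phi q) / (y * phi q) by field; apply/andP.
    rewrite absvM absolute_valueV// absvN absvM vq ltr_pdivrMr ?mulr_gt0//.
  apply/asboolP/Qp_subP => e e0.
  (* [B] bounds [x] and every approximation of [y^-1] with error below 1; whence the [1] in the
     minimum. *)
  pose B := absv x + absv y^-1 + 1.
  have B0 : 0 < B by rewrite ltr_wpDl// addr_ge0 ?absv_ge0.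
  have eB : 0 < Num.min 1 (e / B) by rewrite lt_min ltr01 divr_gt0.
  move/Qp_subP : xQ => /(_ _ eB)[q xq]; move/Qp_subP : yVQ => /(_ _ eB)[r yr].
  exists (q * r); rewrite rmorphM.
  have -> : x / y - phi q * phi r = x * (y^-1 - phi r) + (x - phi q) * phi r by ring.
  move: xq yr; rewrite !lt_min => /andP[xq1 xq2] /andP[yr1 yr2].
  have rB : absv (phi r) <= B.
    rewrite -(subKr y^-1 (phi r)) (ultrametricB_le vabs vum)//.
      by rewrite /B addrAC lerDr addr_ge0 ?absv_ge0.
    by rewrite (le_trans (ltW yr1))// /B lerDr addr_ge0 ?absv_ge0.
  have xB : absv x <= B by rewrite /B -addrA lerDl addr_ge0 ?absv_ge0.
  rewrite ltr_pdivlMr// in xq2; rewrite ltr_pdivlMr// in yr2.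
  rewrite (le_lt_trans (vum _ _))// gt_max !absvM; apply/andP; split.
    by rewrite (le_lt_trans _ yr2)// mulrC ler_wpM2l ?absv_ge0.
  by rewrite (le_lt_trans _ xq2)// ler_wpM2l ?absv_ge0.
Qed.

Hypothesis F_complete :
  forall G : set_system (vtop F), ProperFilter G -> cauchy G -> cvg G.

(** By the ultrametric inequality a whole tail of steps is no larger than its first step, so the
    limit inherits the bound [p ^- n] with no geometric sum. *)
Lemma padic_limit (u : nat -> F) :
  (forall n, absv (u n.+1 - u n) <= p%:R^-1 ^+ n) ->
  exists l, forall n, absv (u n - l) <= p%:R^-1 ^+ n.
Proof.
move=> uu.
have uD n k : absv (u (n + k)%N - u n) <= p%:R^-1 ^+ n.
  elim: k => [|k IH]; first by rewrite addn0 subrr absv0 exprn_ge0 ?ltW.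
  apply: (ultrametric_trans vum _ IH); rewrite addnS (le_trans (uu _))//.
  by rewrite ler_wiXn2l ?ltW// leq_addr.
pose w : nat -> vtop F := u.
have wc : cauchy (w @ \oo).
  apply/cauchy_ballP => e e0; have [n ne] := exprn_pV_lt e0.
  exists ([set w (n + k)%N | k in setT], [set w (n + k)%N | k in setT]).
    split; exists n => // m /= nm; exists (m - n)%N => //; by rewrite subnKC.
  move=> [_ _] [/= [k _ <-] [j _ <-]].
  apply: le_lt_trans ne; apply: (ultrametric_trans vum (uD n k)).
  by rewrite ultrametricC.
have wl : cvg (w @ \oo) by exact: F_complete.
exists (limn w : F) => n; have e0 : 0 < p%:R^-1 ^+ n :> R by rewrite exprn_gt0.
have [m wm] := vtop_cvg_dist wl e0.
have := ltW (wm (n + m)%N (leq_addl _ _)); rewrite (ultrametricC vabs) => lw.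
by rewrite (ultrametricC vabs); apply: (ultrametric_trans vum _ (uD n m));
  rewrite (ultrametricC vabs).
Qed.

End PadicField.

(** * The ring of integers modulo p *)

Section ResidueCosets.
Variables (R : realType) (F : valuedField R) (p : nat) (p_prime : prime p).
Variable phi : {rmorphism rat -> F}.
Hypothesis phi_abs : forall q, absv (phi q) = padic_abs R p q.
Hypothesis F_complete :
  forall G : set_system (vtop F), ProperFilter G -> cauchy G -> cvg G.

Let p_gt0 : 0 < p%:R :> R. Proof. by rewrite ltr0n prime_gt0. Qed.
Let p_gt1 : 1 < p%:R :> R. Proof. by rewrite ltr1n prime_gt1. Qed.
Let pV_lt1 : p%:R^-1 < 1 :> R. Proof. by rewrite invf_lt1. Qed.
Let pV_gt0 : 0 < p%:R^-1 :> R. Proof. by rewrite invr_gt0. Qed.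
Let vum := absv_ultrametric p_prime phi_abs.
Let vabs := absvP F.
Let vM := @absvM R F.
Let vge0 := @absv_ge0 R F.

Let Qp_div x y : x \in @Qp_pred R F -> y \in @Qp_pred R F ->
  x / y \in @Qp_pred R F.
Proof. by have [_ _] := Qp_divring_closed p_prime phi_abs; exact. Qed.

(** Linear independence over the field with [p] elements in the ring of integers modulo [p], with
    natural numbers as coefficients. Reducing modulo [p], not modulo the maximal ideal, makes the
    dimension [d] even when there is ramification. *)
Definition residue_free (m : nat) (x : 'I_m -> F) :=
  (forall i, absv (x i) <= 1) /\
  forall k : 'I_m -> nat,
    absv (\sum_i (k i)%:R * x i) <= p%:R^-1 -> forall i, (p %| k i)%N.

(** Dividing a relation by its largest coefficient [c j] and replacing the quotients by their digits
    gives a relation modulo [p] whose [j]-th coefficient is congruent to 1. *)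
Lemma residue_free_indep (m : nat) (x : 'I_m -> F) : residue_free x ->
  forall c : 'I_m -> F, (forall i, c i \in @Qp_pred R F) ->
    \sum_i c i * x i = 0 -> forall i, c i = 0.
Proof.
move=> [x1 xfree] c cQ cx i0; apply/eqP/negPn/negP => ci0.
pose j := [arg max_(j > i0) absv (c j)]%O.
have jP i : absv (c i) <= absv (c j).
  by rewrite /j; case: Order.TotalTheory.arg_maxP => // j' _; exact.
have cj0 : c j != 0.
  by rewrite -(absolute_value_gt0 vabs) (lt_le_trans _ (jP i0))// absolute_value_gt0.
have cj i : absv (c i / c j) <= 1.
  rewrite vM (absolute_valueV vabs) ler_pdivrMr ?mul1r//.
  by rewrite absolute_value_gt0.
have /choice[k kP] i : exists k : nat, absv (c i / c j - k%:R) <= p%:R^-1.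
  by apply: (Qp_digit p_prime phi_abs) => //; apply/asboolP/Qp_div.
have : absv (\sum_i (k i)%:R * x i) <= p%:R^-1.
  have -> : \sum_i (k i)%:R * x i = - \sum_i (c i / c j - (k i)%:R) * x i.
    under [in RHS]eq_bigr => i _ do rewrite mulrBl mulrAC.
    by rewrite sumrB -mulr_suml cx mul0r sub0r opprK.
  rewrite absvN (ultrametric_sum_le vabs vum) ?ltW// => i _.
  by rewrite vM -[leRHS]mulr1 ler_pM.
move=> /xfree/(_ j); rewrite -(absv_nat_dvd p_prime phi_abs) => kj.
have := kP j; rewrite divff// => kj1.
have : absv (1 : F) <= p%:R^-1 by rewrite -(subrK (k j)%:R 1) (ultrametric_le vum).
by rewrite (absolute_value1 vabs) leNgt pV_lt1.
Qed.

(* Maximality yields a relation modulo p between [y] and the [x i], in which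
   the coefficient of [y] is invertible because the [x i] are independent. *)
Lemma residue_free_span (m : nat) (x : 'I_m -> F) : residue_free x ->
  (forall x' : 'I_m.+1 -> F, ~ residue_free x') ->
  forall y, absv y <= 1 ->
    exists k : 'I_m -> nat, absv (y - \sum_i (k i)%:R * x i) <= p%:R^-1.
Proof.
move=> [x1 xfree] xmax y y1.
pose x' (i : 'I_m.+1) := if unlift ord0 i is Some j then x j else y.
have x'0 : x' ord0 = y by rewrite /x' unlift_none.
have x'S j : x' (lift ord0 j) = x j by rewrite /x' liftK.
have := xmax x'; apply: contra_notP => nk; split.
  by move=> i; rewrite /x'; case: unlift.
move=> k; rewrite big_ord_recl x'0; under eq_bigr => j _ do rewrite x'S.
set s := \sum_j _ => ks.
have pk0 : (p %| k ord0)%N.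
  apply: contrapT => /negP; rewrite -prime_coprime// coprime_sym => pk0.
  apply: nk.
  have k0 : (0 < k ord0)%N.
    rewrite lt0n; apply/eqP => k0; move: pk0; rewrite k0 /coprime gcd0n.
    by rewrite gtn_eqF// prime_gt1.
  have [b c bc _] := egcdnP p k0.
  rewrite (eqP pk0) in bc.
  (* [b] inverts [k ord0] modulo [p], so [y] is congruent to [- b * s]; again [p - 1] replaces
     [-1]. *)
  exists (fun i => (p - 1) * (b * k (lift ord0 i)))%N.
  have -> : \sum_i ((p - 1) * (b * k (lift ord0 i)))%:R * x i =
      (p%:R - 1) * (b%:R * s).
    rewrite !mulr_sumr; apply: eq_bigr => i _; rewrite natrM natrB ?prime_gt0//.
    by rewrite natrM; ring.
  have -> : y - (p%:R - 1) * (b%:R * s) =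
     b%:R * ((k ord0)%:R * y + s) - p%:R * (c%:R * y + b%:R * s).
    have : ((b * k ord0)%:R : F) = (c * p + 1)%:R by rewrite bc.
    by rewrite natrD !natrM => bc'; ring: bc'.
  have nat1 (a : nat) : absv (a%:R : F) <= 1 by exact: absv_nat_le1 phi_abs a.
  have s1 : absv s <= 1.
    apply: (ultrametric_sum_le vabs vum) => // i _.
    by rewrite vM mulr_ile1.
  apply: (ultrametricB_le vabs vum); rewrite vM.
    by rewrite -[leRHS]mul1r ler_pM.
  rewrite (absv_p p_prime phi_abs) -[leRHS]mulr1 ler_wpM2l//.
  by apply: (ultrametric_le vum); rewrite vM mulr_ile1.
have ksy : absv ((k ord0)%:R * y) <= p%:R^-1.
  by rewrite vM -[leRHS]mulr1 ler_pM// (absv_nat_dvd p_prime phi_abs).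
have : absv s <= p%:R^-1.
  by rewrite -(addKr ((k ord0)%:R * y) s) addrC (ultrametricB_le vabs vum).
move=> /xfree ks' i; have [j ->|->//] := unliftP ord0 i; exact: ks'.
Qed.

(* The base [p] expansions of [y] along [x] converge in Q_p. *)
Lemma residue_span_Qp_span (m : nat) (x : 'I_m -> F) :
  (forall i, absv (x i) <= 1) ->
  (forall y, absv y <= 1 ->
    exists k : 'I_m -> nat, absv (y - \sum_i (k i)%:R * x i) <= p%:R^-1) ->
  forall y, exists c : 'I_m -> F, (forall j, c j \in @Qp_pred R F) /\
    y = \sum_j c j * x j.
Proof.
move=> x1 xspan.
have p0 := p_neq0 p_prime phi_abs.
have vp := absv_p p_prime phi_abs.
(* One division step: the digits of [y] along [x], and the integral remainder after dividing by
   [p]. *)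
have step y : exists ky : ('I_m -> nat) * F, absv y <= 1 ->
    y = \sum_i (ky.1 i)%:R * x i + p%:R * ky.2 /\ absv ky.2 <= 1.
  have [y1|y1] := leP (absv y) 1; last by exists ((fun=> 0%N), 0).
  have [k yk] := xspan _ y1.
  exists (k, (y - \sum_i (k i)%:R * x i) / p%:R) => _ /=; split.
    by rewrite mulrC divfK// addrC subrK.
  by rewrite vM (absolute_valueV vabs) vp ler_pdivrMr// mul1r.
have [f fP] := choice step.
have unit_span y : absv y <= 1 -> exists c : 'I_m -> F,
    (forall j, c j \in @Qp_pred R F) /\ y = \sum_j c j * x j.
  move=> y1.
  (* [r n] is the [n]-th remainder, and [S i n] the [n]-th partial sum of the expansion of the
     [i]-th coordinate. *)
  pose r n := iter n (fun z => (f z).2) y.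
  have r1 n : absv (r n) <= 1 by elim: n => // n /fP[].
  pose S (i : 'I_m) n : F := (\sum_(t < n) p ^ t * (f (r t)).1 i)%:R.
  have SS i n : S i n.+1 = S i n + p%:R ^+ n * ((f (r n)).1 i)%:R.
    by rewrite /S big_ord_recr natrD natrM natrX.
  have yS n : y = \sum_i S i n * x i + p%:R ^+ n * r n.
    elim: n => [|n IH].
      by rewrite expr0 mul1r big1 ?add0r// => i _; rewrite /S big_ord0 mul0r.
    rewrite {1}IH {1}(fP _ (r1 n)).1 mulrDr addrA exprSr -mulrA; congr (_ + _).
    rewrite mulr_sumr -big_split; apply: eq_bigr => i _ /=.
    by rewrite SS mulrDl mulrA.
  have nat1 (a : nat) : absv (a%:R : F) <= 1 by exact: absv_nat_le1 phi_abs a.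
  have /choice[c cP] i : exists l, forall n, absv (S i n - l) <= p%:R^-1 ^+ n.
    apply: (padic_limit p_prime phi_abs) => // n; rewrite SS addrAC subrr add0r.
    by rewrite vM (absolute_valueX vabs) vp ler_piMr ?exprn_ge0// ltW.
  exists c; split.
    move=> j; apply/asboolP/(Qp_subP phi) => e e0.
    have [n ne] := exprn_pV_lt p_prime e0.
    exists (\sum_(t < n) p ^ t * (f (r t)).1 j)%:R; rewrite rmorph_nat.
    by rewrite (ultrametricC vabs) (le_lt_trans (cP j n)).
  apply/eqP; rewrite -subr_eq0; apply/eqP.
  have [_ v0 _ _] := vabs; apply/v0/eqP; rewrite eq_le vge0 andbT.
  apply/ler_addgt0Pl => e e0; rewrite addr0.
  have [n ne] := exprn_pV_lt p_prime e0.
  apply: le_trans (ltW ne).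
  rewrite {1}(yS n) addrAC -sumrB (ultrametric_le vum)//.
    rewrite (ultrametric_sum_le vabs vum) ?exprn_ge0 ?ltW// => i _.
    by rewrite -mulrBl vM -[leRHS]mulr1 ler_pM.
  by rewrite vM (absolute_valueX vabs) vp ler_piMr ?exprn_ge0// ltW.
move=> y.
(* A general [y] is first scaled into the unit ball by a power of [p]. *)
have [n ny] : exists n, absv (p%:R ^+ n * y) <= 1.
  have yp : 0 < (absv y + 1)^-1 by rewrite invr_gt0 ltr_wpDl.
  have [n ne] := exprn_pV_lt p_prime yp; exists n.
  rewrite vM (absolute_valueX vabs) vp.
  rewrite (le_trans (ler_wpM2r (vge0 _) (ltW ne)))// mulrC ler_pdivrMr ?mul1r.
    by rewrite lerDl.
  by rewrite ltr_wpDl.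
have [c [cQ cE]] := unit_span _ ny.
exists (fun j => c j / p%:R ^+ n); split.
  move=> j; apply: Qp_div => //; apply/asboolP/(Qp_subP phi) => e e0.
  by exists (p%:R ^+ n); rewrite rmorphXn rmorph_nat subrr absv0.
apply: (mulfI (expf_neq0 n p0)); rewrite cE mulr_sumr; apply: eq_bigr => i _.
by rewrite mulrA [_ * (c i / _)]mulrC divfK// expf_neq0.
Qed.

End ResidueCosets.

Section CosetSystem.
Variables (R : realType) (F : valuedField R).
Let vabs := absvP F.
Let vM := @absvM R F.

(* [z] lists representatives of the ball of radius [r] modulo that of radius
   [e]. *)
Definition coset_system (r e : R) (I : finType) (z : I -> F) :=
  [/\ forall i, absv (z i) <= r,
      forall i j, absv (z i - z j) <= e -> i = j
    & forall y, absv y <= r -> exists i, absv (y - z i) <= e].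

Lemma coset_systemM (a : F) r e (I : finType) (z : I -> F) : a != 0 ->
  coset_system r e z ->
  coset_system (absv a * r) (absv a * e) (fun i => a * z i).
Proof.
move=> a0 [zr ze zc]; have va0 : 0 < absv a by rewrite absolute_value_gt0.
split=> [i|i j|y ya]; first by rewrite vM ler_pM2l.
  by rewrite -mulrBr vM ler_pM2l//; exact: ze.
have [|i yi] := zc (a^-1 * y).
  by rewrite vM (absolute_valueV vabs) ler_pdivrMl.
exists i; rewrite -(mulVKf a0 y) -mulrBr vM ler_pM2l//.
Qed.

Hypothesis vum : ultrametric (@absv R F).

(** Multiplicativity of indices for nested balls: representatives are added. *)
Lemma coset_system_comp r s e (I J : finType) (z : I -> F) (w : J -> F) :
  e <= s -> s <= r -> coset_system r s z -> coset_system s e w ->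
  coset_system r e (fun ij : I * J => z ij.1 + w ij.2).
Proof.
move=> es sr [zr zs zc] [ws we wc]; split.
- by move=> [i j] /=; rewrite (ultrametric_le vum)// (le_trans (ws _)).
- move=> [i j] [i' j'] /= ij.
  have ii : i = i'.
    apply: zs; rewrite (_ : _ - _ = z i + w j - (z i' + w j') - (w j - w j')); last by ring.
    apply: (ultrametricB_le vabs vum); first exact: le_trans es.
    exact: (ultrametricB_le vabs vum).
  subst i'; congr (_, _); apply: we.
  by rewrite (_ : _ - _ = z i + w j - (z i + w j')) //; ring.
- move=> y /zc[i /wc[j yij]]; exists (i, j) => /=.
  by rewrite opprD addrA.
Qed.

Lemma coset_system_sub r r' e (I : finType) (z : I -> F) :
  e <= r' -> r' <= r -> coset_system r e z ->
  coset_system r' e (fun i : {i | absv (z i) <= r'} => z (val i)).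
Proof.
move=> er rr [zr ze zc]; split=> [i|i j /ze ij|y yr]; first exact: (valP i).
  exact: val_inj.
have [i yi] := zc y (le_trans yr rr).
have zi : absv (z i) <= r'.
  by rewrite -(subKr y (z i)) (ultrametricB_le vabs vum)// (le_trans yi).
by exists (exist _ i zi).
Qed.

End CosetSystem.

Section LocalDegree.
Variables (R : realType) (F : valuedField R) (p : nat) (p_prime : prime p).
Variable phi : {rmorphism rat -> F}.
Hypothesis phi_abs : forall q, absv (phi q) = padic_abs R p q.
Hypothesis F_complete :
  forall G : set_system (vtop F), ProperFilter G -> cauchy G -> cvg G.
Variable d : nat.
Hypothesis F_degree : is_local_degree F d.

Let pV_gt0 : 0 < p%:R^-1 :> R. Proof. by rewrite invr_gt0 ltr0n prime_gt0. Qed.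
Let pV_lt1 : p%:R^-1 < 1 :> R.
Proof. by rewrite invf_lt1 ?ltr0n ?prime_gt0// ltr1n prime_gt1. Qed.
Let vum := absv_ultrametric p_prime phi_abs.
Let vabs := absvP F.
Let vM := @absvM R F.
Let vge0 := @absv_ge0 R F.

Lemma local_degree_gt0 : (0 < d)%N.
Proof.
case: F_degree => e eP; case: (posnP d) => // d0.
have [c [[_ +] _]] := eP 1; rewrite big1 => [|i _]; last first.
  by have := ltn_ord i; rewrite {2}d0.
by move/eqP; rewrite oner_eq0.
Qed.

(** A largest family that is independent modulo [p] exists because independence over Q_p bounds its
    size by [d]. By maximality it spans modulo [p], hence over Q_p, so its size is exactly [d]. *)
Lemma residue_basis : exists x : 'I_d -> F, residue_free p x /\
  forall y, absv y <= 1 ->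
    exists k : 'I_d -> nat, absv (y - \sum_i (k i)%:R * x i) <= p%:R^-1.
Proof.
have [e eP] := F_degree.
pose S : divringClosed F := HB.pack (@Qp_pred R F)
  (GRing.isDivringClosed.Build F (@Qp_pred R F) (Qp_divring_closed p_prime phi_abs)).
have S0 : (0 : F) \in @Qp_pred R F by exact: (rpred0 S).
have e_indep (c : 'I_d -> F) : (forall i, c i \in S) ->
    \sum_i c i * e i = 0 -> forall i, c i = 0.
  move=> cS c0 i; have [c' [_ c'_uniq]] := eP 0.
  have /ffunP/(_ i) : [ffun i => c i] = [ffun=> 0] :> {ffun 'I_d -> F}.
    transitivity c'; [symmetry|]; apply: c'_uniq; split.
    - by move=> j; rewrite ffunE; apply/asboolP; exact: cS.
    - by rewrite -[LHS]c0; apply: eq_bigr => j _; rewrite ffunE.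
    - by move=> j; rewrite ffunE; apply/asboolP; exact: S0.
    - by rewrite big1// => j _; rewrite ffunE mul0r.
  by rewrite !ffunE.
have e_span y : exists c : 'I_d -> F, (forall j, c j \in S) /\
    y = \sum_j c j * e j.
  by have [c [[cQ yE] _]] := eP y; exists c; split=> // j; exact/asboolP/cQ.
have free_le m : (exists x : 'I_m -> F, residue_free p x) -> (m <= d)%N.
  move=> [x xfree]; apply: (@divring_indep_le_span _ S _ _ x e) => //.
  exact: (residue_free_indep p_prime phi_abs).
pose P m := `[< exists x : 'I_m -> F, residue_free p x >].
have P0 : exists m, P m.
  by exists 0%N; apply/asboolP; exists (fun=> 0); split=> [[]|k _ []].
have Pd m : P m -> (m <= d)%N by move/asboolP; exact: free_le.
case: (ex_maxnP P0 Pd) => m /asboolP[x xfree] m_max.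
have xspan := residue_free_span p_prime phi_abs xfree.
have md : m = d.
  apply/eqP; rewrite eqn_leq free_le; last by exists x.
  apply: (@divring_indep_le_span _ S _ _ e x) => // y.
  apply: (residue_span_Qp_span p_prime phi_abs F_complete xfree.1).
  apply: xspan => x' x'free.
  by have := m_max m.+1; rewrite ltnn => /implyP; rewrite implybF => /negP; apply;
    apply/asboolP; exists x'.
move: x xfree xspan m_max; rewrite md => x xfree xspan d_max; exists x; split=> //.
apply: xspan => x' x'free.
have : P d.+1 by apply/asboolP; exists x'.
by move/d_max; rewrite ltnn.
Qed.

(** The representatives are the combinations of a basis modulo [p] with digits in [[0, p)], which
    gives [p ^ d] classes. *)
Lemma residue_coset_system : exists z : {ffun 'I_d -> 'I_p} -> F,
  coset_system 1 p%:R^-1 z.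
Proof.
have [x [[x1 xfree] xspan]] := residue_basis.
have nat1 (a : nat) : absv (a%:R : F) <= 1 by exact: absv_nat_le1 phi_abs a.
have natp (a : nat) (y : F) : (p %| a)%N -> absv y <= 1 ->
    absv (a%:R * y) <= p%:R^-1.
  move=> pa y1; rewrite vM -[leRHS]mulr1 ler_pM//.
  by rewrite (absv_nat_dvd p_prime phi_abs).
exists (fun f : {ffun 'I_d -> 'I_p} => \sum_i (f i)%:R * x i); split.
- move=> f; rewrite (ultrametric_sum_le vabs vum)// => i _.
  by rewrite vM mulr_ile1.
- move=> f g fg; apply/ffunP => i; apply/val_inj => /=.
  (* The difference of digits is shifted by [p] so as to be a natural number. It then lies strictly
     between 0 and [2 * p], so if divisible by [p] it equals [p]. *)
  have : absv (\sum_i (f i + (p - g i))%:R * x i) <= p%:R^-1.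
    have -> : \sum_i (f i + (p - g i))%:R * x i =
        (\sum_i (f i)%:R * x i - \sum_i (g i)%:R * x i) + \sum_i p%:R * x i.
      rewrite -sumrB -big_split; apply: eq_bigr => j _ /=.
      by rewrite natrD natrB ?(ltnW (ltn_ord _))//; ring.
    rewrite (ultrametric_le vum)// (ultrametric_sum_le vabs vum) ?ltW// => j _.
    exact: natp.
  move/xfree/(_ i) => pfg.
  have := divnK pfg; have := ltn_ord (f i); have := ltn_ord (g i).
  move: (_ %/ _)%N => q.
  move: (f i : nat) (g i : nat) => a b bp ap.
  case: q => [|[|q]]; rewrite ?mul0n ?mul1n ?mulSn; lia.
- move=> y /xspan[k yk].
  exists [ffun i => Ordinal (ltn_pmod (k i) (prime_gt0 p_prime))].
  apply: (ultrametric_trans vum yk); rewrite -sumrB.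
  rewrite (ultrametric_sum_le vabs vum) ?ltW// => j _; rewrite ffunE /=.
  rewrite -mulrBl -natrB ?leq_mod//; apply: natp => //.
  by rewrite -eqn_mod_dvd ?leq_mod// modn_mod.
Qed.

End LocalDegree.

(** * Volumes of balls *)

Section HaarBalls.
Variables (R : realType) (F : valuedField R).
Variable mu : {measure set (borel F) -> \bar R}.
Hypothesis mu_haar : normalized_haar mu.
Hypothesis vum : ultrametric (@absv R F).
Let vabs := absvP F.

Definition clball (a : F) (r : R) : set (borel F) :=
  [set x : F | absv (x - a) <= r].

(** In an ultrametric space a closed ball of positive radius is open. *)
Lemma measurable_clball a r : 0 < r -> measurable (clball a r).
Proof.
move=> r0; apply: sub_sigma_algebra; rewrite openE => x xa.
apply/vtop_nbhsP; exists r => // y xy; apply: (ultrametric_trans vum _ xa).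
by rewrite (ultrametricC vabs) ltW.
Qed.

Lemma haar_clball a r : 0 < r -> mu (clball a r) = mu (clball 0 r).
Proof.
move=> r0; rewrite -(mu_haar.1 a _ (measurable_clball 0 r0)); congr (mu _).
apply/seteqP; split=> [x xa|_ [x xr <-]].
  by exists (x - a : F); rewrite /clball/= ?subr0// addrC subrK.
by move: xr; rewrite /clball/= subr0 addrAC subrr add0r.
Qed.

Lemma haar_clball1 : mu (clball 0 1) = 1%E.
Proof.
rewrite -mu_haar.2; congr (mu _); apply/seteqP.
by split=> x; rewrite /clball/= subr0.
Qed.

(** The larger ball is the disjoint union of the translates of the smaller one by the
    representatives. *)
Lemma haar_coset_system r e (I : finType) (z : I -> F) : 0 < e -> e <= r ->
  coset_system r e z -> mu (clball 0 r) = (#|I|%:R%:E * mu (clball 0 e))%E.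
Proof.
move=> e0 er [zr ze zc].
have -> : clball 0 r = \bigcup_(i in [set: I]) clball (z i) e.
  apply/seteqP; split=> [x|x [i _ xi]].
    by rewrite /clball/= subr0 => /zc[i xi]; exists i.
  rewrite /clball/= subr0 -(subrK (z i) x) (ultrametric_le vum)//.
  exact: le_trans xi er.
rewrite measure_fin_bigcup//=; last 2 first.
- by move=> i j _ _ [x [xi xj]]; apply: ze; apply: (ultrametric_trans vum _ xj);
    rewrite (ultrametricC vabs).
- by move=> i _; exact: measurable_clball.
rewrite (eq_fsbigr (fun=> mu (clball 0 e))) => [|i _]; last exact: haar_clball.
have -> : [set: I] = [set` enum I].
  by apply/seteqP; split=> // i _; rewrite /= mem_enum.
rewrite -fsbig_seq ?enum_uniq// big_enum/= mule_natl.
by rewrite sumr_const cardT -cardE.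
Qed.

End HaarBalls.

Section HaarPadic.
Variables (R : realType) (F : valuedField R) (p : nat) (p_prime : prime p).
Variable phi : {rmorphism rat -> F}.
Hypothesis phi_abs : forall q, absv (phi q) = padic_abs R p q.
Hypothesis F_complete :
  forall G : set_system (vtop F), ProperFilter G -> cauchy G -> cvg G.
Variable d : nat.
Hypothesis F_degree : is_local_degree F d.
Variable mu : {measure set (borel F) -> \bar R}.
Hypothesis mu_haar : normalized_haar mu.

Let p_gt0 : 0 < p%:R :> R. Proof. by rewrite ltr0n prime_gt0. Qed.
Let p_gt1 : 1 < p%:R :> R. Proof. by rewrite ltr1n prime_gt1. Qed.
Let pV_gt0 : 0 < p%:R^-1 :> R. Proof. by rewrite invr_gt0. Qed.
Let pV_lt1 : p%:R^-1 < 1 :> R. Proof. by rewrite invf_lt1. Qed.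
Let vum := absv_ultrametric p_prime phi_abs.
Let vabs := absvP F.
Let vM := @absvM R F.
Let vge0 := @absv_ge0 R F.
Let p0 := p_neq0 p_prime phi_abs.
Let vp := absv_p p_prime phi_abs.

Let vpX n : absv (p%:R ^+ n : F) = p%:R^-1 ^+ n.
Proof. by rewrite absolute_valueX// vp. Qed.

Let vpVX n : absv (p%:R ^- n : F) = p%:R ^+ n.
Proof. by rewrite absolute_valueV// vpX exprVn invrK. Qed.

Lemma haar_clball_p (a : F) : a != 0 ->
  mu (clball 0 (absv a)) =
  ((p%:R ^+ d)%:E * mu (clball 0 (absv a * p%:R^-1)))%E.
Proof.
move=> a0; have va0 : 0 < absv a by rewrite absolute_value_gt0.
have [z /(coset_systemM a0)] :=
  residue_coset_system p_prime phi_abs F_complete F_degree.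
rewrite mulr1 => /(haar_coset_system mu_haar vum) ->.
- by rewrite card_ffun !card_ord natrX.
- by rewrite mulr_gt0.
- by rewrite ger_pMr// ltW.
Qed.

Lemma haar_clball_pVX n :
  mu (clball 0 (p%:R^-1 ^+ n)) = ((p%:R^-1 ^+ n) ^+ d)%:E.
Proof.
elim: n => [|n IH]; first by rewrite !expr0 expr1n haar_clball1.
have := haar_clball_p (expf_neq0 n p0); rewrite vpX IH -exprSr => hE.
rewrite [in RHS]exprSr [in RHS]exprMn mulrC EFinM hE muleA -EFinM -exprMn mulVf ?gt_eqF//.
by rewrite expr1n mul1e.
Qed.

Lemma haar_clball_pX n : mu (clball 0 (p%:R ^+ n)) = ((p%:R ^+ n) ^+ d)%:E.
Proof.
elim: n => [|n IH]; first by rewrite !expr0 expr1n haar_clball1.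
have pn0 : (p%:R : F) ^- n.+1 != 0 by rewrite invr_eq0 expf_neq0.
have := haar_clball_p pn0; rewrite vpVX => ->.
by rewrite exprSr mulfK ?gt_eqF// IH -EFinM -exprMn mulrC.
Qed.

Lemma coset_system1_pVX n : exists (I : finType) (z : I -> F),
  coset_system 1 (p%:R^-1 ^+ n) z.
Proof.
elim: n => [|n [I [z zn]]].
  exists unit, (fun=> 0); rewrite expr0.
  split=> [_|[] []//|y y1]; first by rewrite absv0.
  by exists tt; rewrite subr0.
have [w] := residue_coset_system p_prime phi_abs F_complete F_degree.
move=> /(coset_systemM (expf_neq0 n p0)); rewrite vpX mulr1 -exprSr => wn.
exists _, (fun ij => z ij.1 + p%:R ^+ n * w ij.2).
apply: (coset_system_comp vum _ _ zn wn).
  by rewrite ler_wiXn2l ?ltW.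
by rewrite exprn_ile1// ltW.
Qed.

(** Representatives are obtained on a ball of radius [p ^+ k >= r], by scaling a system of the unit
    ball, and those in the ball of radius [r] are kept. *)
Lemma coset_system_pVX_exists (r : R) n : p%:R^-1 ^+ n <= r ->
  exists (I : finType) (z : I -> F), coset_system r (p%:R^-1 ^+ n) z.
Proof.
move=> nr.
pose k := Num.Def.archi_bound r.
have rk : r <= p%:R ^+ k.
  apply: le_trans (ltW (upper_nthrootP (leqnn _))) _.
  by rewrite lerXn2r ?nnegrE// ?ler0n// ler_nat prime_gt1.
have [I [z]] := coset_system1_pVX (k + n).
have pk0 : (p%:R : F) ^- k != 0 by rewrite invr_eq0 expf_neq0.
move=> /(coset_systemM pk0); rewrite vpVX mulr1 exprD mulrA -exprMn.
rewrite divff ?gt_eqF// expr1n mul1r => zk.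
by eexists _, _; apply: (coset_system_sub vum nr rk zk).
Qed.

(** Multiplication by [a] carries the decomposition of one ball to the next, so each step multiplies
    the volume by [#|I|]. *)
Lemma haar_coset_systemX (a : F) (I : finType) (z : I -> F) n : 1 <= absv a ->
  coset_system (absv a) 1 z ->
  mu (clball 0 (absv a ^+ n)) = (#|I|%:R ^+ n)%:E.
Proof.
move=> a1 az; have a0 : a != 0.
  by rewrite -(absolute_value_gt0 vabs) (lt_le_trans _ a1).
elim: n => [|n IH]; first by rewrite !expr0 haar_clball1.
have := coset_systemM (expf_neq0 n a0) az.
rewrite absolute_valueX// mulr1 -exprSr => /(haar_coset_system mu_haar vum) ->.
- by rewrite IH -EFinM exprS.
- by rewrite exprn_gt0// (lt_le_trans _ a1).
- by rewrite ler_weXn2l.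
Qed.

(* Powers of [a] reduce the estimate to balls whose radius is a power of p, up
   to a factor that disappears when taking roots. *)
Lemma coset_system_card1 (a : F) (I : finType) (z : I -> F) : 1 <= absv a ->
  coset_system (absv a) 1 z -> #|I|%:R <= absv a ^+ d.
Proof.
move=> a1 az; apply: (@le_of_exprn_le _ (p%:R ^+ d)) => [//||n].
  by rewrite exprn_ge0.
(* [p ^+ k] is the least power of [p] above [absv a ^+ n]; the rounding costs at most a factor [p],
   hence [p ^+ d] in volume. *)
have [k ak kp] : exists2 k, absv a ^+ n <= p%:R ^+ k &
    p%:R ^+ k <= p%:R * absv a ^+ n.
  have an1 : 1 <= absv a ^+ n by rewrite exprn_ege1.
  have ex : exists k, absv a ^+ n <= p%:R ^+ k.
    exists (Num.Def.archi_bound (absv a ^+ n)).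
    apply: le_trans (ltW (upper_nthrootP (leqnn _))) _.
    by rewrite lerXn2r ?nnegrE// ?ler0n// ler_nat prime_gt1.
  case: (ex_minnP ex) => -[|k] ak k_min; [exists 0%N | exists k.+1] => //.
    by rewrite expr0 mulr_ege1// ltW.
  rewrite exprS ler_pM2l// leNgt; apply/negP => /ltW/k_min.
  by rewrite ltnn.
have : (mu (clball 0 (absv a ^+ n)) <= mu (clball 0 (p%:R ^+ k)))%E.
  apply: le_measure; rewrite ?inE.
  - by apply: (measurable_clball vum); rewrite exprn_gt0// (lt_le_trans _ a1).
  - by apply: (measurable_clball vum); rewrite exprn_gt0.
  - by move=> x /le_trans; apply.
rewrite (haar_coset_systemX n a1 az) haar_clball_pX lee_fin => /le_trans; apply.
apply: le_trans (_ : (p%:R * absv a ^+ n) ^+ d <= _).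
  by rewrite lerXn2r// nnegrE ?mulr_ge0 ?exprn_ge0// ltW.
rewrite exprMn exprAC -mulrA ler_wpM2l ?exprn_ge0//.
by rewrite ler_peMl ?exprn_ge0// ler1n.
Qed.

(** The radius [r] need not be an absolute value. It is lowered to that of the largest
    representative, or to [p ^- n] if all are smaller; scaling by [p ^- n] in [F] then makes the
    small radius 1. *)
Lemma coset_system_card (r : R) n (I : finType) (z : I -> F) :
  p%:R^-1 ^+ n <= r -> coset_system r (p%:R^-1 ^+ n) z ->
  #|I|%:R * (p%:R^-1 ^+ n) ^+ d <= r ^+ d.
Proof.
set e := p%:R^-1 ^+ n => er [zr ze zc].
have e0 : 0 < e by rewrite exprn_gt0.
have [i0 _] : exists i, absv (0 - z i) <= e.
  by apply: zc; rewrite absv0 (le_trans _ er)// ltW.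
pose j := [arg max_(j > i0) absv (z j)]%O.
have jP i : absv (z i) <= absv (z j).
  by rewrite /j; case: Order.TotalTheory.arg_maxP => // j' _; exact.
have [a [ea ar az]] : exists a : F, [/\ e <= absv a, absv a <= r &
    coset_system (absv a) e z].
  case: (leP e (absv (z j))) => [ej|/ltW je].
    by exists (z j); split=> //; split=> // y yj; apply: zc; exact: le_trans (zr j).
  exists (p%:R ^+ n); rewrite vpX; split=> //.
  by split=> // [i|y ye]; [exact: le_trans je | apply: zc; exact: le_trans er].
pose b := (p%:R : F) ^- n.
have b0 : b != 0 by rewrite invr_eq0 expf_neq0.
have vb : absv b = e^-1 by rewrite vpVX /e exprVn invrK.
have := coset_systemM b0 az; rewrite -vM vb mulVf ?gt_eqF// => /coset_system_card1.
rewrite vM vb mulrC ler_pdivlMr// mul1r => /(_ ea).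
rewrite exprMn exprVn ler_pdivlMr ?exprn_gt0// => /le_trans; apply.
have r0 : 0 <= r by rewrite (le_trans (ltW e0)).
by apply: lerXn2r; rewrite ?nnegrE.
Qed.

Lemma ball_cover (r : R) n : p%:R^-1 ^+ n <= r -> exists zs : seq F,
  (size zs)%:R * (p%:R^-1 ^+ n) ^+ d <= r ^+ d /\ forall y, absv y <= r ->
    exists2 z, z \in zs & absv (y - z) <= p%:R^-1 ^+ n.
Proof.
move=> er; have [I [z zs]] := coset_system_pVX_exists er.
exists (codom z); split; first by rewrite size_codom (coset_system_card er zs).
have [_ _ zc] := zs.
by move=> y /zc[i yi]; exists (z i) => //; exact: codom_f.
Qed.

End HaarPadic.

(** * The radius of convergence of the exponential *)

Lemma logn_fact_le (p n : nat) : prime p -> ((p - 1) * logn p n`! <= n)%N.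
Proof.
move=> p_prime; rewrite logn_fact//.
have p1 := prime_gt1 p_prime.
(* The term [n %/ p ^ K] makes the induction telescope, since
   [p * (n %/ p ^ K.+1) <= n %/ p ^ K]. *)
suff H K : ((p - 1) * (\sum_(1 <= k < K.+1) n %/ p ^ k) + n %/ p ^ K <= n)%N.
  by apply: leq_trans (H n); exact: leq_addr.
elim: K => [|K IH]; first by rewrite big_nil muln0 expn0 divn1.
rewrite big_nat_recr//= mulnDr -addnA; apply: leq_trans IH; rewrite leq_add2l.
rewrite -[X in (_ + X <= _)%N]mul1n -mulnDl subnK ?(ltnW p1)// expnS.
by rewrite mulnC [(p * _)%N]mulnC divnMA leq_trunc_div.
Qed.

Section ExpRadius.
Variables (R : realType) (p : nat).
Hypothesis p_prime : prime p.

Lemma exp_radius_gt0 : 0 < exp_radius R p.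
Proof. by rewrite powR_gt0// ltr0n prime_gt0. Qed.

Lemma exp_radius_le1 : exp_radius R p <= 1.
Proof.
rewrite /exp_radius -[leRHS](powRr0 p%:R) ler_powR ?ler1n ?prime_gt0//.
by rewrite oppr_le0 invr_ge0 subr_ge0 ler1n prime_gt0.
Qed.

Lemma exp_radius_fact (n : nat) :
  exp_radius R p ^+ n <= p%:R^-1 ^+ logn p n`!.
Proof.
have p1 := prime_gt1 p_prime.
have <- : exp_radius R p ^+ (p - 1) = p%:R^-1.
  rewrite -powR_mulrn ?(ltW exp_radius_gt0)// /exp_radius -powRrM.
  rewrite natrB ?(ltnW p1)// mulNr mulVf ?powR_inv1//.
  by rewrite subr_eq0 pnatr_eq1 gtn_eqF.
rewrite -exprM ler_wiXn2l ?exp_radius_le1 ?(ltW exp_radius_gt0)//.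
exact: logn_fact_le.
Qed.

End ExpRadius.

(** * Elimination in a finite ultrametric space *)

(* Eliminating the points of a finite ultrametric space one at a time: the
   pair [(i, j)] removes [j] using its comparison with [i], at distance less
   than [rho], and [(j, j)] removes [j] on its own. *)
Section Elimination.
Variables (R : realType) (T : finType) (D : T -> T -> R) (rho : R).
Hypothesis D_xx : forall i, D i i = 0.
Hypothesis D_sym : forall i j, D i j = D j i.
Hypothesis D_um : forall i j k, D i k <= Num.max (D i j) (D j k).
Hypothesis D_ge0 : forall i j, 0 <= D i j.

Fixpoint elimination (S : {set T}) (l : seq (T * T)) : bool :=
  if l is (i, j) :: l' then
    [&& j \in S, (i == j) || (i \in S) && (D i j < rho)
      & elimination (S :\ j) l']
  else #|S| == 0.

Definition elim_factor (ij : T * T) (k : T) : R :=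
  if ij.1 == ij.2 then Num.max (D ij.2 k) rho
  else Num.max (D ij.1 k) (D ij.2 k).

Hypothesis rho_ge0 : 0 <= rho.

(** Every point is removed on its own. *)
Lemma elimination_far (S : {set T}) :
  exists2 l, elimination S l & forall k,
    \prod_(ij <- l) elim_factor ij k = \prod_(j in S) Num.max (D j k) rho.
Proof.
have [n] := ubnP #|S|; elim: n S => // n IH S Sn.
have [S0|/card_gt0P[j jS]] := posnP #|S|.
  exists [::] => [|k]; first by rewrite /= S0.
  by rewrite big_nil big_pred0// => i; rewrite (card0_eq S0).
have [|l lS lE] := IH (S :\ j); first by rewrite (cardsD1 j S) jS in Sn.
exists ((j, j) :: l) => [|k]; first by rewrite /= jS eqxx.
rewrite big_cons lE (big_setD1 j jS)/=; congr (_ * _).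
by rewrite /elim_factor eqxx.
Qed.

(** Points of [S] other than [i] are equidistant from [i] and [j]. At [i] itself, [D i j] replaces
    [D i i = 0], but the maximum is attained by the other term, [rho] or a distance at least
    [D i j]. *)
Lemma elim_factor_near (i j : T) (S : {set T}) l : elimination S l ->
  D i j < rho ->
  (forall a, a \in S -> a != i -> D a j = D a i /\ D i j <= D a i) ->
  \prod_(ab <- l) elim_factor ab j = \prod_(ab <- l) elim_factor ab i.
Proof.
move=> lS ij; elim: l S lS => [|[a b] l IH] S /=; first by rewrite !big_nil.
move=> /and3P[bS abS lS] SD; rewrite !big_cons (IH _ lS); last first.
  by move=> c; rewrite !inE => /andP[_]; exact: SD.
congr (_ * _); rewrite /elim_factor/=.
have [ab|ab] := eqVneq a b.
  have [->|bi] := eqVneq b i; last by have [-> _] := SD _ bS bi.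
  by rewrite D_xx !max_r// ltW.
have aS : a \in S by move: abS; rewrite (negPf ab) => /andP[].
have [ai|ai] := eqVneq a i.
  have bi : b != i by rewrite -ai eq_sym.
  have [-> ji] := SD _ bS bi.
  by rewrite ai D_xx !max_r.
have [-> ji] := SD _ aS ai.
have [->|bi] := eqVneq b i; last by have [-> _] := SD _ bS bi.
by rewrite D_xx !max_l.
Qed.

(** Induction on [S], removing a point [j] of a closest pair [(i, j)]. The step contributes [D j k]
    for [k != j], as [i] is no farther from [k] than [j]; for [k = j] it contributes [D i j], and
    the remaining factors are those at [i]. *)
Lemma elimination_exists (S : {set T}) :
  exists2 l, elimination S l & forall k, k \in S ->
    \prod_(ij <- l) elim_factor ij k = rho * \prod_(j in S :\ k) D j k.
Proof.
have [n] := ubnP #|S|; elim: n S => // n IH S Sn.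
pose near (ij : T * T) := [&& ij.1 \in S, ij.2 \in S, ij.1 != ij.2 & D ij.1 ij.2 < rho].
have [ij0 ij0S|far] := pickP near; last first.
  have [l lS lE] := elimination_far S; exists l => // k kS.
  rewrite lE (big_setD1 k kS)/= D_xx max_r//; congr (_ * _).
  apply: eq_bigr => j; rewrite !inE => /andP[jk jS]; apply: max_l.
  by have := far (j, k); rewrite /near/= jS kS jk/= leNgt => ->.
case: (Order.TotalTheory.arg_minP (fun ij => D ij.1 ij.2) ij0S) => -[i j].
move=> /and4P[/= iS jS ij Dij] ij_min {ij0 ij0S}.
(* The minimum was taken over pairs closer than [rho]; the other pairs are farther apart anyway. *)
have ij_le a b : a \in S -> b \in S -> a != b -> D i j <= D a b.
  move=> aS bS ab; have [lt|ge] := ltP (D a b) rho.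
    by apply: (ij_min (a, b)); rewrite /near/= aS bS ab lt.
  exact: le_trans (ltW Dij) ge.
have Dj k : k \in S -> k != j -> D i k <= D j k.
  move=> kS kj; apply: le_trans (D_um i j k) _.
  by rewrite ge_max lexx andbT ij_le// eq_sym.
have Di k : k \in S -> k != i -> D j k <= D i k.
  move=> kS ki; apply: le_trans (D_um j i k) _.
  by rewrite ge_max lexx andbT D_sym ij_le// eq_sym.
have [|l lS lE] := IH (S :\ j); first by rewrite (cardsD1 j S) jS in Sn.
have iSj : i \in S :\ j by rewrite !inE ij.
exists ((i, j) :: l) => [|k kS]; first by rewrite /= jS iS Dij orbT lS.
rewrite big_cons {1}/elim_factor/= (negPf ij).
have [->|kj] := eqVneq k j.
  rewrite (@elim_factor_near i j _ _ lS Dij); last first.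
    move=> a; rewrite !inE => /andP[aj aS] ai; split; last by rewrite ij_le.
    by rewrite [LHS]D_sym [RHS]D_sym; apply/eqP; rewrite eq_le Dj// Di.
  rewrite lE// D_xx max_l// mulrCA [in RHS](big_setD1 i)/=; last by rewrite !inE ij.
  congr (_ * (_ * _)); apply: eq_big => [a|a]; first by rewrite !inE andbCA.
  rewrite !inE => /and3P[ai aj aS].
  by rewrite D_sym [RHS]D_sym; apply/eqP; rewrite eq_le Dj// Di.
have kSj : k \in S :\ j by rewrite !inE kj.
rewrite (lE _ kSj) mulrCA; congr (_ * _).
rewrite [in RHS](big_setD1 j)/=; last by rewrite !inE eq_sym kj.
rewrite max_r ?Dj//; congr (_ * _).
by apply: eq_bigl => a; rewrite !inE andbCA.
Qed.

End Elimination.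

(** * Coverings by cubes *)

Section Covering.
Variables (R : realType) (F : valuedField R) (p : nat) (p_prime : prime p).
Variable phi : {rmorphism rat -> F}.
Hypothesis phi_abs : forall q, absv (phi q) = padic_abs R p q.
Let pV_gt0 : 0 < p%:R^-1 :> R. Proof. by rewrite invr_gt0 ltr0n prime_gt0. Qed.
Let vum := absv_ultrametric p_prime phi_abs.
Let vabs := absvP F.
Let vM := @absvM R F.
Let vge0 := @absv_ge0 R F.

(* If the series diverges then its [lim] is the default point [0]. *)
Lemma absv_vexp_le1 (x : F) : absv x < exp_radius R p -> absv (vexp x) <= 1.
Proof.
move=> xr; rewrite /vexp.
pose u : nat -> vtop F := series (fun k : nat => x ^+ k / k`!%:R : F).
rewrite -/u.
have u1 n : absv (u n : F) <= 1.
  rewrite /u /series/= (ultrametric_sum_le vabs vum)// => k _.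
  (* Each term has absolute value at most 1, because [absv x ^+ k <= exp_radius R p ^+ k <= absv
     k!]. *)
  rewrite vM (absolute_valueX vabs) (absolute_valueV vabs).
  rewrite (absv_nat phi_abs) ?fact_gt0// ler_pdivrMr ?exprn_gt0// mul1r.
  apply: le_trans (exp_radius_fact R p_prime k).
  by apply: lerXn2r; rewrite ?nnegrE// ltW// exp_radius_gt0.
have [/(fun uc => vtop_cvg_dist uc ltr01)[N /(_ _ (leqnn N)) uN]|ud] :=
    pselect (cvgn u).
  by rewrite -(subrK (u N : F) (limn u)) (ultrametric_le vum)// ltW.
by rewrite dvgP// absv0.
Qed.

Hypothesis F_complete :
  forall G : set_system (vtop F), ProperFilter G -> cauchy G -> cvg G.
Variable d : nat.
Hypothesis F_degree : is_local_degree F d.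
Variable mu : {measure set (borel F) -> \bar R}.
Hypothesis mu_haar : normalized_haar mu.
Variables (s : nat) (D : 'I_s -> 'I_s -> R) (rho : R).
Variables (e : 'I_s -> 'I_s -> F) (rad : 'I_s * 'I_s -> R) (m : nat).
Hypothesis e_xx : forall i, e i i = 0.
Hypothesis e_le1 : forall i j, D i j < rho -> absv (e i j) <= 1.
Hypothesis rad_ge : forall ij, p%:R^-1 ^+ m <= rad ij.

(** Induction along [l]: once [x i] is known to within [p ^- m], the relation between [x i] and
    [x j] leaves for [x j] a ball of radius [rad (i, j)], to be covered by small balls. *)
Lemma elimination_cover (S : {set 'I_s}) l : elimination D rho S l ->
  exists cs : seq {ffun 'I_s -> F},
    (size cs)%:R * (p%:R^-1 ^+ m) ^+ d ^+ #|S| <= \prod_(ij <- l) rad ij ^+ d /\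
    forall x : 'I_s -> F,
      (forall i j, (i == j) || (D i j < rho) ->
        absv (x i * e i j - x j) <= rad (i, j)) ->
      exists2 c, c \in cs & forall j, j \in S -> absv (x j - c j) <= p%:R^-1 ^+ m.
Proof.
elim: l S => [|[i j] l IH] S /=.
  move=> /eqP S0; exists [:: [ffun=> 0]]; rewrite big_nil S0 mul1r expr0.
  split=> // x _; exists [ffun=> 0]; rewrite ?mem_seq1// => j.
  by rewrite (card0_eq S0).
move=> /and3P[jS ijS /IH[cs [cs_size cs_cover]]].
have [zs [zs_size zs_cover]] :=
  ball_cover p_prime phi_abs F_complete F_degree mu_haar (rad_ge (i, j)).
(* Here [z] approximates [x i * e i j - x j]. The formula also covers [i = j], where [e i i = 0] and
   the centre is [- z]. *)
exists [seq [ffun k => if k == j then c i * e i j - z else c k] |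
  c : {ffun 'I_s -> F} <- cs, z <- zs]; split.
  rewrite size_allpairs mulnC natrM (cardsD1 j) jS add1n exprS big_cons mulrACA.
  by rewrite ler_pM// mulr_ge0// !exprn_ge0// ltW.
move=> x xC; have [c c_cs xc] := cs_cover _ xC.
have ij : (i == j) || (D i j < rho).
  by case/orP : ijS => [->//|/andP[_ ->]]; rewrite orbT.
have [z z_zs xz] := zs_cover _ (xC _ _ ij).
exists [ffun k => if k == j then c i * e i j - z else c k].
  exact: allpairs_f.
move=> k kS; rewrite ffunE; case: eqVneq => [->|kj]; last first.
  by apply: xc; rewrite !inE kj.
have -> : x j - (c i * e i j - z) =
    (x i - c i) * e i j - (x i * e i j - x j - z) by ring.
apply: (ultrametricB_le vabs vum) => //; rewrite vM.
case/orP : ijS => [/eqP ->|/andP[iS Dij]].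
  by rewrite e_xx absv0 mulr0 exprn_ge0 ?ltW.
have [ijE|ij'] := eqVneq i j; first by rewrite ijE e_xx absv0 mulr0 exprn_ge0 ?ltW.
rewrite -[leRHS]mulr1 ler_pM ?e_le1// xc//.
by rewrite !inE ij'.
Qed.

End Covering.

(** * Cubes and the product measure *)

Section ProductMeasure.
Variables (R : realType) (F : valuedField R) (s : nat).
Hypothesis vum : ultrametric (@absv R F).
Variable mu : {measure set (borel F) -> \bar R}.
Hypothesis mu_haar : normalized_haar mu.
Variable muS : {measure set (s.-tuple (borel F)) -> \bar R}.
Hypothesis muS_product : is_product_measure mu muS.
Let vabs := absvP F.

Definition cube (r : R) (c : 'I_s -> F) : set (s.-tuple (borel F)) :=
  [set x | forall i, clball (c i) r (tnth x i)].

Lemma measurable_cube r c : 0 < r -> measurable (cube r c).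
Proof.
move=> r0.
have -> : cube r c =
    \bigcap_(i in [set: 'I_s]) ((@tnth s (borel F))^~ i @^-1` clball (c i) r).
  by apply/seteqP; split=> [x xc i _|x xc i]; exact: xc.
apply: fin_bigcap_measurable => // i _.
rewrite -[X in measurable X]setTI; apply: measurable_tnth => //.
exact: (measurable_clball vum).
Qed.

Lemma measure_cube r c : 0 < r -> muS (cube r c) = (\prod_(i < s) mu (clball 0 r))%E.
Proof.
move=> r0; transitivity (\prod_(i < s) mu (clball (c i) r))%E.
  apply: (muS_product (A := fun i => clball (c i) r)) => i.
  exact: (measurable_clball vum).
by apply: eq_bigr => i _; rewrite (haar_clball mu_haar vum).
Qed.

(* A set that is a union of cubes of side [r] is the union of those cubes of
   any finite cover that it meets. *)
Lemma measure_le_cover (r b : R) (C : set (s.-tuple (borel F)))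
    (cs : seq {ffun 'I_s -> F}) : 0 < r -> 0 <= b ->
  mu (clball 0 r) = b%:E ->
  (forall x y : s.-tuple (borel F), C x ->
    (forall i, absv ((tnth x i : F) - tnth y i) <= r) -> C y) ->
  (forall x, C x -> exists2 c : {ffun 'I_s -> F}, c \in cs &
    forall i, absv ((tnth x i : F) - c i) <= r) ->
  (muS C <= ((size cs)%:R * b ^+ s)%:E)%E.
Proof.
move=> r0 b0 mub C_stable C_cover.
(* Cubes that miss [C] are replaced by the empty set, so that the finite union is exactly [C], which
   is thereby measurable. *)
pose A (c : {ffun 'I_s -> F}) := if `[< cube r c `&` C !=set0 >] then cube r c else set0.
have mA c : measurable (A c).
  by rewrite /A; case: ifP => // _; exact: measurable_cube.
have muA c : (muS (A c) <= (b ^+ s)%:E)%E.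
  rewrite /A; case: ifP => _; last by rewrite measure0 lee_fin exprn_ge0.
  rewrite measure_cube// mub prodEFin lee_fin prodr_const card_ord//.
have -> : C = \big[setU/set0]_(c <- cs) A c.
  rewrite -bigcup_seq; apply/seteqP; split=> [x Cx|x [c _]].
    have [c c_cs xc] := C_cover _ Cx; exists c => //; rewrite /A.
    by have -> : `[< cube r c `&` C !=set0 >] by apply/asboolP; exists x.
  rewrite /A; case: asboolP => // -[y [yc Cy]] xc; apply: C_stable Cy _ => i.
  apply: (ultrametric_trans vum (yc i)).
  by rewrite (ultrametricC vabs); exact: xc.
elim: cs {C_cover} => [|c cs IH]; first by rewrite big_nil measure0 mul0r.
have -> : (size (c :: cs))%:R = (size cs)%:R + 1 :> R by rewrite natr1.
rewrite big_cons mulrDl mul1r addrC EFinD.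
apply: le_trans (measureU2 _ _ _) _ => //.
  exact: bigsetU_measurable.
by apply: leeD; [exact: muA | exact: IH].
Qed.

End ProductMeasure.

(** * The volume of [Cset] *)

Lemma size_elimination (R : realType) (T : finType) (D : T -> T -> R) rho
  (S : {set T}) l : elimination D rho S l -> size l = #|S|.
Proof.
elim: l S => [|[i j] l IH] S /=; first by move/eqP.
by move=> /and3P[jS _ /IH ->]; rewrite (cardsD1 j S) jS.
Qed.

Lemma exprn_pV_le_family (R : realType) (p : nat) (I : finType) (f : I -> R) :
  prime p -> (forall i, 0 < f i) -> exists n, forall i, p%:R^-1 ^+ n <= f i.
Proof.
move=> p_prime f0.
have /choice[n nP] i : exists n, p%:R^-1 ^+ n <= f i.
  by have [n /ltW] := exprn_pV_lt p_prime (f0 i); exists n.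
exists (\max_i n i)%N => i; apply: le_trans (nP i).
have p0 : 0 < p%:R :> R by rewrite ltr0n prime_gt0.
have p1 : 1 <= p%:R :> R by rewrite ler1n prime_gt0.
by apply: ler_wiXn2l; rewrite ?leq_bigmax ?invr_ge0 ?invf_le1// ltW.
Qed.

Lemma poweR_root (R : realType) (b : R) (d : nat) : (0 < d)%N -> 0 <= b ->
  poweR (b ^+ d)%:E d%:R^-1 = b%:E.
Proof.
move=> d0 b0; rewrite poweR_EFin -powR_mulrn// -powRrM divff ?powRr1//.
by rewrite pnatr_eq0 gtn_eqF.
Qed.

Lemma poweR_le_root (R : realType) (x : \bar R) (b : R) (d : nat) : (0 < d)%N ->
  0 <= b -> (0 <= x)%E -> (x <= (b ^+ d)%:E)%E -> (poweR x d%:R^-1 <= b%:E)%E.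
Proof.
move=> d0 b0 x0 xb; rewrite -(poweR_root d0 b0); apply: gt0_ler_poweR => //.
  by rewrite in_itv/= x0 leey.
by rewrite in_itv/= leey andbT lee_fin exprn_ge0.
Qed.

Theorem theorem10p1 (R : realType) (K : fieldExtType rat)
  (s : nat) (alpha : 'I_s -> K) (alpha_inj : injective alpha)
  (p : nat) (p_prime : prime p)
  (v : K -> R) (v_above_p : place_above p v)
  (Kv : valuedField R) (iota : {rmorphism K -> Kv})
  (Kv_completion : is_completion v iota)
  (d : nat) (d_degree : is_local_degree Kv d)
  (mu : {measure set (borel Kv) -> \bar R}) (mu_haar : normalized_haar mu)
  (muS : {measure set (s.-tuple (borel Kv)) -> \bar R})
  (muS_product : is_product_measure mu muS)
  (n : 'I_s -> nat) (n_pos : forall i, (0 < n i)%N) :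
  (poweR (muS (Cset alpha n p v iota)) d%:R^-1
     <= ((p%:R ^+ 3 * (nsum n)%:R) ^+ s * v (Delta alpha n))%:E)%E /\
  ((forall i j, i != j -> v (alpha i - alpha j) = 1) ->
   poweR (muS (Cset alpha n p v iota)) d%:R^-1 = (v (Delta alpha n))%:E).
Proof.
have [v_abs v_rat] := v_above_p.
have [iota_v _ Kv_complete] := Kv_completion.
pose phi : {rmorphism rat -> Kv} := iota \o in_alg K.
have phi_abs q : absv (phi q) = padic_abs R p q.
  by rewrite /= iota_v -v_rat; congr (v _); exact: (fmorph_eq_rat (in_alg K)).
have d0 := local_degree_gt0 d_degree.
have vum := absv_ultrametric p_prime phi_abs.
have v_nat k : v k%:R = absv (k%:R : Kv) by rewrite -iota_v rmorph_nat.
have v_um : ultrametric v by move=> x y; rewrite -!iota_v rmorphD.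
have [v_ge0 v0 vM vD] := v_abs.
pose w := p%:R ^+ 3 * (nsum n)%:R : R.
have w_ge1 : (0 < s)%N -> 1 <= w.
  move=> s0; have N1 : (0 < nsum n)%N.
    rewrite /nsum (bigD1 (Ordinal s0))//=.
    by rewrite (leq_trans (n_pos (Ordinal s0)))// leq_addr.
  by rewrite /w -natrX -natrM ler1n muln_gt0 expn_gt0 prime_gt0.
have fact_v i : v (n i).-1`!%:R = p%:R^-1 ^+ logn p (n i).-1`!.
  by rewrite v_nat (absv_nat phi_abs) ?fact_gt0.
have pV0 k : 0 < p%:R^-1 ^+ k :> R.
  by rewrite exprn_gt0// invr_gt0 ltr0n prime_gt0.
(* The factors of [Delta] are regrouped by the exponent [n k], as the elimination will produce
   them. *)
have vDelta : v (Delta alpha n) = \prod_(i < s) v (n i).-1`!%:R *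
    \prod_(k < s) \prod_(i < s | i != k) v (alpha i - alpha k) ^+ n k.
  rewrite /Delta (absolute_value_prod v_abs).
  under eq_bigr => i _ do rewrite vM (absolute_value_prod v_abs).
  rewrite big_split/=; congr (_ * _).
  rewrite (exchange_big_dep xpredT)//=; apply: eq_bigr => k _.
  apply: eq_big => [i|i _]; first by rewrite eq_sym.
  by rewrite (absolute_valueX v_abs).
(* Outside E the set is a product of balls whose radii are powers of [p], so its measure is known
   exactly. *)
have notE_eq : ~ in_E alpha v ->
    poweR (muS (Cset alpha n p v iota)) d%:R^-1 = (v (Delta alpha n))%:E.
  move=> notE.
  have v1 i j : i != j -> v (alpha i - alpha j) = 1.
    move=> ij; apply/eqP/negPn/negP => vij; apply: notE; right; split=> //.
    by exists i, j.
  have -> : Cset alpha n p v iota = [set x | forall i,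
      clball 0 (p%:R^-1 ^+ logn p (n i).-1`!) (tnth x i)].
    apply/seteqP; split=> [x [_ /(_ notE) xC] i|x xC].
      by have := xC i; rewrite fact_v /clball/= subr0.
    split=> [//|_ i]; have := xC i; by rewrite fact_v /clball/= subr0.
  rewrite (muS_product (fun i => clball 0 (p%:R^-1 ^+ logn p (n i).-1`!))); last first.
    by move=> i; exact: (measurable_clball vum).
  under eq_bigr => i _ do
    rewrite (haar_clball_pVX p_prime phi_abs Kv_complete d_degree mu_haar).
  rewrite prodEFin prodrXl poweR_root//; last first.
    by rewrite prodr_ge0// => i _; exact: ltW.
  rewrite vDelta [X in _ * X]big1 ?mulr1; last first.
    by move=> k _; rewrite big1// => i ik; rewrite v1// expr1n.
  by congr (_%:E); apply: eq_bigr => i _; rewrite fact_v.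
split; last first.
  move=> v1; apply: notE_eq => -[/(_ v_um)//|[_ [i [j [ij /eqP]]]]].
  by apply; exact: v1.
have [v_inE|/notE_eq ->] := pselect (in_E alpha v); last first.
  rewrite lee_fin ler_peMl//.
  (* For [s = 0] one has [w = 0], and the bound rests on [w ^+ 0 = 1]. *)
  have exp_ge1 (y : R) : ((0 < s)%N -> 1 <= y) -> 1 <= y ^+ s.
    by have [->|s0 y1] := posnP s; rewrite ?expr0 ?exprn_ege1 ?y1.
  exact: exp_ge1.
pose D i j := v (alpha i - alpha j).
pose rho := exp_radius R p.
have rho0 : 0 < rho by exact: exp_radius_gt0.
have D_xx i : D i i = 0 by rewrite /D subrr (absolute_value0 v_abs).
have D_sym i j : D i j = D j i by rewrite /D (ultrametricC v_abs).
have D_um i j k : D i k <= Num.max (D i j) (D j k).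
  by apply: le_trans (v_um _ _); rewrite addrA subrK.
have D_ge0 i j : 0 <= D i j by exact: v_ge0.
have D_gt0 i j : (0 < D i j) = (i != j).
  by rewrite (absolute_value_gt0 v_abs) subr_eq0 (inj_eq alpha_inj).
have s0 : (0 < s)%N.
  case: (v_inE) => [/(_ v_um)//|[_ [i _]]].
  exact: leq_ltn_trans (ltn_ord i).
have w0 : 0 < w by apply: lt_le_trans (w_ge1 s0).
pose rad ij := w * \prod_(k < s) elim_factor D rho ij k ^+ n k.
have factor_gt0 ij k : 0 < elim_factor D rho ij k.
  case: ij => i j; rewrite /elim_factor/=; case: eqVneq => [_|ij].
    by rewrite lt_max rho0 orbT.
  rewrite lt_max !D_gt0 -negb_and; apply: contra ij => /andP[/eqP -> /eqP ->].
  exact: eqxx.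
have rad_gt0 ij : 0 < rad ij.
  by rewrite mulr_gt0// prodr_gt0// => k _; rewrite exprn_gt0.
(* A side [p ^- m] below all radii makes [Cset] stable under perturbations of that size. *)
have [m rad_ge] := exprn_pV_le_family p_prime rad_gt0.
(* With 0 on the diagonal, the bound on [x i] alone takes the same form as the relations between
   pairs. *)
pose e i j : Kv := if i == j then 0 else vexp (iota (alpha j - alpha i)).
have e_xx i : e i i = 0 by rewrite /e eqxx.
have e_le1 i j : D i j < rho -> absv (e i j) <= 1.
  move=> Dij; rewrite /e; case: eqVneq => [_|_]; first by rewrite absv0.
  by apply: (absv_vexp_le1 p_prime phi_abs); rewrite iota_v (ultrametricC v_abs).
have C_eq (x : s.-tuple (borel Kv)) : Cset alpha n p v iota x <->
    forall i j, (i == j) || (D i j < rho) ->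
      absv ((tnth x i : Kv) * e i j - tnth x j) <= rad (i, j).
  split=> [[/(_ v_inE)[Ci Cij] _] i j|xC].
    have [->|ij] := eqVneq i j.
      move=> _; rewrite e_xx mulr0 sub0r absvN /rad /elim_factor/= eqxx.
      exact: Ci.
    move=> /= Dij; rewrite /rad /elim_factor/= (negPf ij) /e (negPf ij).
    by apply: Cij; rewrite -[v _]/(D j i) D_gt0 eq_sym ij D_sym.
  split=> // _; split=> [i|i j].
    have := xC i i; rewrite eqxx e_xx mulr0 sub0r absvN /rad /elim_factor/= eqxx.
    exact.
  rewrite -[v _]/(D j i) D_gt0 eq_sym D_sym => /andP[ij Dij].
  have := xC i j; rewrite /rad /elim_factor/= (negPf ij) /e (negPf ij) Dij.
  exact.
have [l l_elim l_prod] :=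
  elimination_exists D_xx D_sym D_um D_ge0 (ltW rho0) (finset.setTfor 'I_s).
have [cs [cs_size cs_cover]] := elimination_cover p_prime phi_abs Kv_complete
  d_degree mu_haar e_xx e_le1 rad_ge l_elim.
apply: poweR_le_root => //.
  by rewrite mulr_ge0// exprn_ge0// ltW.
have C_stable (x y : s.-tuple (borel Kv)) : Cset alpha n p v iota x ->
    (forall i, absv ((tnth x i : Kv) - tnth y i) <= p%:R^-1 ^+ m) ->
    Cset alpha n p v iota y.
  move=> /C_eq xC xy; apply/C_eq => i j ij.
  have e1 : absv (e i j) <= 1.
    by case/orP : ij => [/eqP ->|/e_le1//]; rewrite e_xx absv0.
  have -> : (tnth y i : Kv) * e i j - tnth y j =
      ((tnth x i : Kv) * e i j - tnth x j) -
      ((tnth x i - tnth y i) * e i j - (tnth x j - tnth y j)).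
    by ring.
  apply: (ultrametricB_le (absvP Kv) vum); first exact: xC.
  apply: (ultrametricB_le (absvP Kv) vum); last exact: le_trans (xy j) (rad_ge _).
  rewrite absvM -[leRHS]mulr1 ler_pM ?absv_ge0//.
  exact: le_trans (xy i) (rad_ge _).
have C_cover (x : s.-tuple (borel Kv)) : Cset alpha n p v iota x ->
    exists2 c : {ffun 'I_s -> Kv}, c \in cs &
      forall i, absv ((tnth x i : Kv) - c i) <= p%:R^-1 ^+ m.
  move=> /C_eq/(cs_cover (tnth x : 'I_s -> Kv))[c c_cs xc]; exists c => // i.
  by apply: xc; rewrite finset.in_setT.
apply: le_trans (measure_le_cover vum mu_haar muS_product (pV0 m) _
  (haar_clball_pVX p_prime phi_abs Kv_complete d_degree mu_haar m)
  C_stable C_cover) _.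
  by rewrite exprn_ge0// ltW.
rewrite lee_fin; rewrite cardsT card_ord in cs_size.
apply: le_trans cs_size _; rewrite prodrXl.
have prod_ge0 : 0 <= \prod_(ij <- l) rad ij by rewrite prodr_ge0// => ij _; exact: ltW.
apply: lerXn2r; rewrite ?nnegrE//.
  by rewrite mulr_ge0// exprn_ge0// ltW.
(* The list has one entry per point, so the constants [w] contribute [w ^+ s]. *)
rewrite /rad big_split/= big_const_seq count_predT iter_mulr_1.
rewrite (size_elimination l_elim) cardsT card_ord ler_wpM2l ?exprn_ge0 ?(ltW w0)//.
rewrite exchange_big/= vDelta.
have -> : \prod_(k < s) \prod_(ij <- l) elim_factor D rho ij k ^+ n k =
    \prod_(k < s) rho ^+ n k *
    \prod_(k < s) \prod_(i < s | i != k) D i k ^+ n k.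
  rewrite -big_split/=; apply: eq_bigr => k _.
  rewrite prodrXl l_prod ?finset.in_setT// exprMn -prodrXl; congr (_ * _).
  by apply: eq_bigl => i; rewrite !inE andbT.
apply: ler_wpM2r.
  by rewrite prodr_ge0// => k _; rewrite prodr_ge0// => i _; rewrite exprn_ge0.
apply: ler_prod => k _; rewrite exprn_ge0 ?(ltW rho0)//= fact_v.
(* Legendre's bound applies to [(n k).-1], and [rho ^+ n k <= rho ^+ (n k).-1] because
   [rho <= 1]. *)
apply: le_trans (exp_radius_fact R p_prime _).
by rewrite ler_wiXn2l ?(ltW rho0)// ?exp_radius_le1// leq_pred.
Qed.
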